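(* Let $\mathcal{C}$ be a super-modular category with fermionic symmetry action $[\rho]:G_b\to\mathrm{Aut}_{LR}(\mathcal{C})$ for the fermionic symmetry group determined by $\omega_2=(-1)^{\tilde\omega_2}\in Z^2(G_b,\mathbb{Z}_2)$. Fix a minimal modular extension $\check{\mathcal{C}}$, let $r:\mathrm{Aut}_{LR}(\check{\mathcal{C}})\to\mathrm{Aut}_{LR}(\mathcal{C})$ be the restriction map, assume that $\ker r$ is Abelian, and suppose that for each ${\bf g}\in G_b$ there is a lift $[\check{\rho}_{\bf g}]\in\mathrm{Aut}_{LR}(\check{\mathcal{C}})$ with $r([\check{\rho}_{\bf g}])=[\rho_{\bf g}]$. Define $$o_2({\bf g,h})=\begin{cases}[\check{\rho}_{\bf gh}\check{\rho}_{\bf h}^{-1}\check{\rho}_{\bf g}^{-1}] & \text{if }\check{\Upsilon}_\psi\text{ respects locality},\\ [\check{\rho}_{\bf gh}\check{\rho}_{\bf h}^{-1}\check{\rho}_{\bf g}^{-1}\check{\Upsilon}_\psi^{\tilde\omega_2({\bf g,h})}] & \text{if }\check{\Upsilon}_\psi\text{ violates locality}.\end{cases}$$ Then $o_2\in Z^2(G_b,\ker r)$, where ${\bf g}\in G_b$ acts on $\ker r$ by conjugation by $[\check{\rho}_{\bf g}]$; changing the choice of lifts changes $o_2$ by a $(\ker r)$-valued 2-coboundary; and the lifts $[\check{\rho}_{\bf g}]$ can be chosen so that (i) $[\check{\rho}_{\bf g}][\check{\rho}_{\bf h}]=[\check{\rho}_{\bf gh}]$ for all ${\bf g,h}$, if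 $\check{\Upsilon}_\psi$ respects locality, or (ii) $[\check{\Upsilon}_\psi]^{\tilde\omega_2({\bf g,h})}[\check{\rho}_{\bf g}][\check{\rho}_{\bf h}]=[\check{\rho}_{\bf gh}]$ for all ${\bf g,h}$, if $\check{\Upsilon}_\psi$ violates locality, if and only if $[o_2]\in\mathcal{H}^2(G_b,\ker r)$ is trivial.
   Context: A super-modular category $\mathcal{C}$ is a unitary braided fusion category with exactly one nontrivial simple object $\psi$ that braids trivially with all objects, where $\psi$ is a fermion: $\theta_\psi=-1$, $\psi\times\psi=1$. A minimal modular extension $\check{\mathcal{C}}$ is a UMTC containing $\mathcal{C}$ as a full braided fusion subcategory, with $\mathcal{D}_{\check{\mathcal{C}}}^2=2\mathcal{D}_{\mathcal{C}}^2$. For $\mathcal{B}=\mathcal{C}$ or $\check{\mathcal{C}}$: a topological autoequivalence is a braided autoequivalence (unitary) or braided anti-autoequivalence (anti-unitary) fixing $\psi$. Natural isomorphisms act on fusion vertices as $|a,b;c;\mu\rangle\mapsto\frac{\gamma_a\gamma_b}{\gamma_c}|a,b;c;\mu\rangle$, $\gamma_a\in\mathrm{U}(1)$; one ''respects locality'' if it can be written with $\gamma_\psi=+1$, and otherwise ''violates locality''. $\mathrm{Aut}_{LR}(\mathcal{B})$ is the group of topological autoequivalences acting trivially on $|\psi,\psi;1\rangle$, modulo locality-respecting natural isomorphisms; brackets denote classes in it. $\Upsilon_\psi$ (on $\mathcal{C}$) and $\check{\Upsilon}_\psi$ (on $\check{\mathcal{C}}$) are the natural isomorphisms with $\gamma_\psi=-1$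 and $\gamma_a=1$ for all other $a$; $r([\check{\Upsilon}_\psi])=[\Upsilon_\psi]$, and if $\check{\Upsilon}_\psi$ respects locality then so does $\Upsilon_\psi$. The full symmetry group $G_f$ is a central extension of $G_b$ by fermion parity $\mathbb{Z}_2^f$ with cocycle $\omega_2=(-1)^{\tilde\omega_2}$, $\tilde\omega_2\in\{0,1\}$; each ${\bf g}\in G_b$ is unitary or anti-unitary according to a homomorphism $G_b\to\mathbb{Z}_2$, and $\rho_{\bf g}$ is unitary or anti-unitary accordingly. The symmetry action satisfies: $[\rho]$ is a group homomorphism if $\Upsilon_\psi$ respects locality, and $[\Upsilon_\psi]^{\tilde\omega_2({\bf g,h})}[\rho_{\bf g}][\rho_{\bf h}]=[\rho_{\bf gh}]$ if $\Upsilon_\psi$ violates locality. *)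

(* Defs.v *)
From HB Require Import structures.
From mathcomp Require Import all_boot all_order fingroup perm all_algebra.
From mathcomp Require Import spectral mxtens complex boolp reals generic_quotient ring.

Set Implicit Arguments.
Unset Strict Implicit.
Unset Printing Implicit Defensive.

Import Order.TTheory GRing.Theory Num.Theory.

Record normalSubgroup (G : groupType) := NormalSubgroup {
  nsub_pred :> {pred G};
  nsub1 : 1%g \in nsub_pred;
  nsubF : forall x y, x \in nsub_pred -> y \in nsub_pred ->
    (x / y)%g \in nsub_pred;
  nsubJ : forall x y, x \in nsub_pred -> (y^-1 * (x * y))%g \in nsub_pred
}.

Section QuotientGroup.
Local Open Scope group_scope.
Local Open Scope quotient_scope.
Variables (G : groupType) (N : normalSubgroup G).
Implicit Types x y z : G.

Definition eqmod x y := x^-1 * y \in N.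

Lemma nsubV x : x \in N -> x^-1 \in N.
Proof. by move=> Nx; rewrite -[x^-1]mul1g nsubF ?nsub1. Qed.
Lemma nsubM x y : x \in N -> y \in N -> x * y \in N.
Proof. by move=> Nx Ny; rewrite -[y]invgK nsubF ?nsubV. Qed.

Lemma eqmod_refl : reflexive eqmod.
Proof. by move=> x; rewrite /eqmod mulVg nsub1. Qed.
Lemma eqmod_sym : symmetric eqmod.
Proof. by move=> x y; apply/idP/idP => /nsubV; rewrite invgM invgK. Qed.
Lemma eqmod_trans : transitive eqmod.
Proof.
move=> y x z h1 h2; have := nsubM h1 h2.
by rewrite -mulgA mulVKg.
Qed.

Canonical eqmod_equiv := EquivRel eqmod eqmod_refl eqmod_sym eqmod_trans.
Definition quotg := {eq_quot eqmod}.
HB.instance Definition _ := Choice.on quotg.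
HB.instance Definition _ := EqQuotient.on quotg.


Definition cls x : quotg := \pi_quotg x.

Lemma cls_repr (p : quotg) : cls (repr p) = p.
Proof. exact: reprK. Qed.
Lemma clsP x y : reflect (cls x = cls y) (x^-1 * y \in N).
Proof. exact: generic_quotient.eqmodP. Qed.

Definition quotg_mul (p q : quotg) : quotg := cls (repr p * repr q).
Definition quotg_inv (p : quotg) : quotg := cls (repr p)^-1.

Lemma quotg_clsM x y : quotg_mul (cls x) (cls y) = cls (x * y).
Proof.
apply/clsP; have /clsP hx := cls_repr (cls x); have /clsP hy := cls_repr (cls y).
set x' := repr _ in hx *; set y' := repr _ in hy *.
have -> : (x' * y')^-1 * (x * y) = (y'^-1 * y) * (y^-1 * ((x'^-1 * x) * y)).
  by rewrite invgM !mulgA mulgK.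
by rewrite nsubM ?nsubJ.
Qed.

Lemma quotg_clsV x : quotg_inv (cls x) = cls x^-1.
Proof.
apply/clsP; have /clsP hx := cls_repr (cls x); rewrite invgK.
set x' := repr _ in hx *.
have -> : x' * x^-1 = (x'^-1)^-1 * ((x'^-1 * x)^-1 * x'^-1).
  by rewrite invgM !invgK -!mulgA mulgV mulg1.
by rewrite nsubJ ?nsubV.
Qed.

Lemma quotg_mulA : associative quotg_mul.
Proof.
move=> p q r; rewrite -(cls_repr p) -(cls_repr q) -(cls_repr r).
by rewrite !quotg_clsM mulgA.
Qed.
Lemma quotg_mul1 : left_id (cls 1) quotg_mul.
Proof. by move=> p; rewrite -(cls_repr p) quotg_clsM mul1g. Qed.
Lemma quotg_mulr1 : right_id (cls 1) quotg_mul.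
Proof. by move=> p; rewrite -(cls_repr p) quotg_clsM mulg1. Qed.
Lemma quotg_mulV : left_inverse (cls 1) quotg_inv quotg_mul.
Proof. by move=> p; rewrite -(cls_repr p) quotg_clsV quotg_clsM mulVg. Qed.
Lemma quotg_mulrV : right_inverse (cls 1) quotg_inv quotg_mul.
Proof. by move=> p; rewrite -(cls_repr p) quotg_clsV quotg_clsM mulgV. Qed.

HB.instance Definition _ := isGroup.Build quotg
  quotg_mulA quotg_mul1 quotg_mulr1 quotg_mulV quotg_mulrV.

Lemma clsM x y : cls (x * y) = cls x * cls y.
Proof. by rewrite -quotg_clsM. Qed.
End QuotientGroup.

Local Open Scope ring_scope.
Local Open Scope sesquilinear_scope.

Section BraidedFusion.
Variable C : numClosedFieldType.

(* The simple objects form the finite set [label]; an orthonormal basis of all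
   the fusion spaces is indexed by ['I_nv], where the basis vertex
   x = |a, b; c; mu> has legs (src1 x, src2 x, tgt x) = (a, b, c).  Thus the
   fusion multiplicity N_ab^c is the number of x with legs (a, b, c), and
   operators between fusion spaces are matrices indexed by basis vertices:
   - the associator sends |a,b;e>|e,c;d> (the pair x, y) to the combination
     of the |b,c;f>|a,f;d> (the pairs z, w) with coefficients
     [F^{abc}_d]_(x,y),(z,w), see [Fsym];
   - the braiding sends the vertex x in V_ab^c to the combination of the y in
     V_ba^c with coefficients [Rmx x y]. *)
Record skeleton := Skeleton {
  label : finType;
  nv : nat;
  src1 : 'I_nv -> label;
  src2 : 'I_nv -> label;
  tgt : 'I_nv -> label;
  vac : label;
  dual : label -> label;
  qdim : label -> C;
  Fmx : 'M[C]_(nv * nv);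
  Rmx : 'M[C]_nv
}.

Section Skeleton.
Variable B : skeleton.
Implicit Types (a b c d : label B) (x y z w : 'I_(nv B)).

Definition legs x := (src1 x, src2 x, tgt x).
Definition fus a b c : nat := #|[set x | legs x == (a, b, c)]|.
Definition Fsym x y z w : C :=
  Fmx B (mxtens_index (x, y)) (mxtens_index (z, w)).

(* x, y compose to ((a b) c) -> d, resp. z, w compose to (a (b c)) -> d *)
Definition ltree x y := tgt x == src1 y.
Definition rtree z w := tgt z == src2 w.
End Skeleton.

(* [qdim] is part of the data for convenience only: the quantum
   (Frobenius-Perron) dimension is the unique positive character of the fusion
   ring.  In the skeletal gauge all the unit constraints are identities, so
   that the triangle axiom takes the form [F_triangle]. *)
Record is_ubfc (B : skeleton) : Prop := IsUBFC {
  fus1l : forall a b : label B, fus (vac B) a b = (a == b);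
  fus1r : forall a b : label B, fus a (vac B) b = (a == b);
  fusA : forall a b c d : label B,
    (\sum_e fus a b e * fus e c d = \sum_f fus b c f * fus a f d)%N;
  fus_dual : forall a b : label B, fus a b (vac B) = (b == dual a);
  fus_dualM : forall a b c : label B,
    fus (dual b) (dual a) (dual c) = fus a b c;
  qdim_gt0 : forall a : label B, 0 < qdim a;
  qdimM : forall a b : label B,
    qdim a * qdim b = \sum_c (fus a b c)%:R * qdim c;
  F_supp : forall x y z w : 'I_(nv B), Fsym x y z w != 0 ->
    [/\ ltree x y, rtree z w &
        (src1 x, src2 x, src2 y, tgt y) = (src1 w, src1 z, src2 z, tgt w)];
  F_unitl : forall x y x' y' : 'I_(nv B), ltree x y -> ltree x' y' ->
    \sum_z \sum_w Fsym x y z w * (Fsym x' y' z w)^*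
      = ((x == x') && (y == y'))%:R;
  F_unitr : forall z w z' w' : 'I_(nv B), rtree z w -> rtree z' w' ->
    \sum_x \sum_y (Fsym x y z w)^* * Fsym x y z' w'
      = ((z == z') && (w == w'))%:R;
  F_triangle : forall x y z w : 'I_(nv B),
    src2 x = vac B -> src1 z = vac B -> ltree x y -> rtree z w ->
    src1 x = src1 w -> src2 z = src2 y ->
    Fsym x y z w = (y == w)%:R;
  (* ((ab)c)d, given by x, y, z, to a(b(cd)), given by u, v, w *)
  F_pentagon : forall x y z u v w : 'I_(nv B),
    \sum_t Fsym y z u t * Fsym x t v w
      = \sum_m \sum_n \sum_k Fsym x y m n * Fsym n z k w * Fsym m k u v;
  (* rigidity: [F^{a a* a}_a]_{1,1} is nonzero *)
  F_rigid : forall (a : label B) (x y z w : 'I_(nv B)),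
    legs x = (a, dual a, vac B) -> legs y = (vac B, a, a) ->
    legs z = (dual a, a, vac B) -> legs w = (a, vac B, a) ->
    Fsym x y z w != 0;
  R_supp : forall x y : 'I_(nv B), Rmx B x y != 0 ->
    legs y = (src2 x, src1 x, tgt x);
  R_unit : Rmx B \is unitarymx;
  (* (ab)c, given by x, y, to b(ca), given by u, v; [Rmx^t*] is the inverse
     braiding *)
  R_hexagon : forall x y u v : 'I_(nv B),
    \sum_z \sum_w \sum_t Fsym x y z w * Rmx B w t * Fsym z t u v
      = \sum_s \sum_t Rmx B x s * Fsym s y t v * Rmx B t u;
  R_hexagonV : forall x y u v : 'I_(nv B),
    \sum_z \sum_w \sum_t Fsym x y z w * (Rmx B)^t* w t * Fsym z t u v
      = \sum_s \sum_t (Rmx B)^t* x s * Fsym s y t v * (Rmx B)^t* t u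
}.

Record ubfc := UBFC { ubfc_skel :> skeleton; ubfcP : is_ubfc ubfc_skel }.

(* topological twist: d_a theta_a = \sum_c d_c Tr(R^{aa}_c) *)
Definition twist (B : skeleton) (a : label B) : C :=
  \sum_(x | (src1 x == a) && (src2 x == a)) qdim (tgt x) / qdim a * Rmx B x x.

Definition total_dim2 (B : skeleton) : C := \sum_(a : label B) qdim a ^+ 2.

(* the double braiding of a and b is the identity *)
Definition braids_trivially (B : skeleton) (a b : label B) : Prop :=
  forall x y : 'I_(nv B), src1 x = a -> src2 x = b ->
    (Rmx B *m Rmx B) x y = (x == y)%:R.

Definition transparent (B : skeleton) (a : label B) : Prop :=
  forall b : label B, braids_trivially a b.

Definition modular (B : skeleton) : Prop :=
  forall a : label B, transparent a <-> a = vac B.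

Record fubfc := FUBFC {
  fubfc_ubfc :> ubfc;
  psi : label fubfc_ubfc;
  psi_neq_vac : psi != vac fubfc_ubfc;
  psi_psi : forall c : label fubfc_ubfc,
    fus psi psi c = (c == vac fubfc_ubfc);
  twist_psi : twist psi = -1
}.

Definition super_modular (B : fubfc) : Prop :=
  forall a : label B, transparent a <-> a = vac B \/ a = psi B.

(* [D] contains [B] as the full braided fusion subcategory on the labels in
   the image of [emb]: its vertices are all the vertices of [D] with legs in
   this image *)
Record min_mod_ext (B D : fubfc) := MinModExt {
  emb : label B -> label D;
  vemb : 'I_(nv B) -> 'I_(nv D);
  emb_inj : injective emb;
  vemb_inj : injective vemb;
  emb_vac : emb (vac B) = vac D;
  emb_psi : emb (psi B) = psi D;
  legs_vemb : forall x : 'I_(nv B),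
    legs (vemb x) = (emb (src1 x), emb (src2 x), emb (tgt x));
  vemb_full : forall y : 'I_(nv D), src1 y \in codom emb ->
    src2 y \in codom emb -> y \in codom vemb;
  emb_F : forall x y z w : 'I_(nv B),
    Fsym (vemb x) (vemb y) (vemb z) (vemb w) = Fsym x y z w;
  emb_R : forall x y : 'I_(nv B), Rmx D (vemb x) (vemb y) = Rmx B x y;
  ext_modular : modular D;
  ext_dim : total_dim2 D = 2%:R * total_dim2 B
}.

Definition cconj (s : bool) (z : C) : C := if s then z^* else z.

(* The autoequivalence acts by phi on labels, and maps the basis vertex x to
   \sum_y (T x y) y; it is linear, and braided, if s = false, and antilinear,
   and a braided anti-autoequivalence, if s = true.  The vacuum vertices are
   fixed, as required by the choice of trivial unit constraints. *)
Record is_topaut (B : fubfc) (phi : {perm label B}) (s : bool)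
    (T : 'M[C]_(nv B)) : Prop := IsTopAut {
  topaut_vac : phi (vac B) = vac B;
  topaut_psi : phi (psi B) = psi B;
  topaut_supp : forall x y, T x y != 0 ->
    legs y = (phi (src1 x), phi (src2 x), phi (tgt x));
  topaut_unitary : T \is unitarymx;
  topaut_F : (T *t T) *m Fmx B = map_mx (cconj s) (Fmx B) *m (T *t T);
  topaut_R : T *m Rmx B = map_mx (cconj s) (Rmx B) *m T;
  topaut_unit : forall x y, src1 x = vac B \/ src2 x = vac B ->
    legs y = (phi (src1 x), phi (src2 x), phi (tgt x)) -> T x y = 1;
  topaut_psipsi : forall x, legs x = (psi B, psi B, vac B) -> T x x = 1
}.

Definition topaut (B : fubfc) :=
  {p : {perm label B} * bool * 'M[C]_(nv B) |
    `[< is_topaut p.1.1 p.1.2 p.2 >]}.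
HB.instance Definition _ (B : fubfc) := Choice.on (topaut B).

Lemma cconj_is_zmod s : zmod_morphism (cconj s).
Proof. by case: s => x y //=; rewrite rmorphB. Qed.
Lemma cconj_is_monoid s : monoid_morphism (cconj s).
Proof. by case: s; split=> [|x y] //=; rewrite ?rmorph1 ?rmorphM. Qed.
HB.instance Definition _ s :=
  GRing.isZmodMorphism.Build C C (cconj s) (cconj_is_zmod s).
HB.instance Definition _ s :=
  GRing.isMonoidMorphism.Build C C (cconj s) (cconj_is_monoid s).

Lemma cconjD s s' z : cconj s (cconj s' z) = cconj (s (+) s') z.
Proof. by case: s s' => [] []; rewrite //= conjCK. Qed.
Lemma map_cconjD s s' m n (A : 'M[C]_(m, n)) :
  map_mx (cconj s) (map_mx (cconj s') A) = map_mx (cconj (s (+) s')) A.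
Proof. by apply/matrixP=> i j; rewrite !mxE cconjD. Qed.
Lemma map_cconjK s m n (A : 'M[C]_(m, n)) :
  map_mx (cconj s) (map_mx (cconj s) A) = A.
Proof. by rewrite map_cconjD addbb; apply/matrixP=> i j; rewrite mxE. Qed.
Lemma map_cconj_trC s m n (A : 'M[C]_(m, n)) :
  map_mx (cconj s) (A ^t*) = (map_mx (cconj s) A) ^t*.
Proof. by apply/matrixP=> i j; rewrite !mxE; case: s. Qed.
Lemma map_cconj_unitary s n (A : 'M[C]_n) :
  A \is unitarymx -> map_mx (cconj s) A \is unitarymx.
Proof.
move=> /unitarymxP hA; apply/unitarymxP; by rewrite -map_cconj_trC -map_mxM hA map_mx1.
Qed.
Lemma unitarymxV n (A : 'M[C]_n) : A \is unitarymx -> A ^t* *m A = 1%:M.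
Proof. by move=> /unitarymxP/mulmx1C. Qed.

Lemma tens11 n : (1%:M : 'M[C]_n) *t (1%:M : 'M[C]_n) = 1%:M.
Proof.
apply/matrixP=> i j; case: (mxtens_indexP i) => i0 i1; case: (mxtens_indexP j) => j0 j1.
by rewrite tensmxE !mxE -natrM mulnb (can_eq (@mxtens_indexK _ _)) xpair_eqE.
Qed.
Lemma tens_trC n (A : 'M[C]_n) : (A *t A) ^t* = A ^t* *t A ^t*.
Proof. by apply/matrixP=> i j; rewrite !mxE rmorphM. Qed.
Lemma tens_unitary n (A : 'M[C]_n) : A \is unitarymx -> A *t A \is unitarymx.
Proof.
move=> /unitarymxP hA; apply/unitarymxP; by rewrite tens_trC tensmx_mul hA tens11.
Qed.

Lemma mulmx_neq0 m n p (A : 'M[C]_(m, n)) (A' : 'M[C]_(n, p)) x y :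
  (A *m A') x y != 0 -> exists2 z, A x z != 0 & A' z y != 0.
Proof.
rewrite mxE => h; have [[z hz]|h0] := pselect (exists z, A x z * A' z y != 0).
  by move: hz; rewrite mulf_eq0 negb_or => /andP[? ?]; exists z.
by case/eqP: h; apply: big1 => z _; apply/eqP/negP => /negP hz; apply: h0; exists z.
Qed.

Section TopAutGroup.
Variable B : fubfc.
Notation preaut := ({perm label B} * bool * 'M[C]_(nv B))%type.
Implicit Types (phi : {perm label B}) (s : bool) (T : 'M[C]_(nv B)).
Implicit Types (al be : topaut B).

Definition aut_perm al : {perm label B} := (val al).1.1.
Definition aut_anti al : bool := (val al).1.2.
Definition aut_mx al : 'M[C]_(nv B) := (val al).2.

Lemma topautP al : is_topaut (aut_perm al) (aut_anti al) (aut_mx al).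
Proof. by apply/asboolP; case: al. Qed.

Lemma is_topaut_in (p : preaut) : is_topaut p.1.1 p.1.2 p.2 ->
  `[< is_topaut p.1.1 p.1.2 p.2 >].
Proof. by move=> h; apply/asboolP. Qed.

Definition mk_topaut phi s T (h : is_topaut phi s T) : topaut B :=
  exist _ (phi, s, T) (@is_topaut_in (phi, s, T) h).

(* the vertex types on which autoequivalences are required to be trivial *)
Let pinned (x : 'I_(nv B)) := [\/ src1 x = vac B, src2 x = vac B |
  legs x = (psi B, psi B, vac B)].

Lemma pinned_uniq x y : pinned x -> legs x = legs y -> x = y.
Proof.
move=> px; suff h : (fus (src1 x) (src2 x) (tgt x) <= 1)%N.
  by move=> xy; move/card_le1_eqP: h; apply; rewrite inE -?xy.
have [P _] : exists P : is_ubfc B, True by exists (ubfcP B).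
case: px => [->|->|[-> -> ->]]; rewrite ?(fus1l P) ?(fus1r P) ?psi_psi; by case: eqP.
Qed.

Lemma topaut_pinned phi s T x y : is_topaut phi s T -> pinned x ->
  legs y = (phi (src1 x), phi (src2 x), phi (tgt x)) -> T x y = 1.
Proof.
move=> h [hx|hx|hx] xy; try by apply: (topaut_unit h) xy; auto.
suff -> : y = x by apply: (topaut_psipsi h).
apply/esym/pinned_uniq; first by apply: Or33.
by move: hx; rewrite xy /legs => -[-> -> ->]; rewrite (topaut_psi h) (topaut_vac h).
Qed.

Lemma pinnedP phi s T x y : is_topaut phi s T -> pinned x ->
  legs y = (phi (src1 x), phi (src2 x), phi (tgt x)) -> pinned y.
Proof.
move=> h [hx|hx|[h1 h2 h3]] [e1 e2 e3]; rewrite /pinned /legs e1 e2 e3.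
- by apply: Or31; rewrite hx (topaut_vac h).
- by apply: Or32; rewrite hx (topaut_vac h).
- by apply: Or33; rewrite h1 h2 h3 (topaut_vac h) (topaut_psi h).
Qed.

Lemma is_topaut1 : is_topaut (1%g : {perm label B}) false 1%:M.
Proof.
split; rewrite ?perm1 //.
- move=> x y; rewrite !mxE !perm1; case: (x =P y) => [->//|_]; by rewrite eqxx.
- by rewrite qualifE /= trmx1 map_mx1 mulmx1.
- have -> : map_mx (cconj false) (Fmx B) = Fmx B by apply/matrixP=> i j; rewrite mxE.
  by rewrite tens11 mulmx1 mul1mx.
- have -> : map_mx (cconj false) (Rmx B) = Rmx B by apply/matrixP=> i j; rewrite mxE.
  by rewrite mulmx1 mul1mx.
- move=> x y px; rewrite !perm1 => xy.
  rewrite (@pinned_uniq x y) ?xy ?mxE ?eqxx //.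
  by case: px => ?; [apply: Or31 | apply: Or32].
- by move=> x _; rewrite mxE eqxx.
Qed.

Lemma is_topautM phi1 s1 T1 phi2 s2 T2 :
  is_topaut phi1 s1 T1 -> is_topaut phi2 s2 T2 ->
  is_topaut (phi2 * phi1)%g (s1 (+) s2) (map_mx (cconj s1) T2 *m T1).
Proof.
move=> h1 h2.
have supp x y : (map_mx (cconj s1) T2 *m T1) x y != 0 ->
    exists z, legs z = (phi2 (src1 x), phi2 (src2 x), phi2 (tgt x)) /\
     legs y = (phi1 (src1 z), phi1 (src2 z), phi1 (tgt z)).
  move=> /mulmx_neq0[z]; rewrite mxE fmorph_eq0 => /(topaut_supp h2) xz.
  by move=> /(topaut_supp h1) zy; exists z.
have pin x y : pinned x ->
  legs y = ((phi2 * phi1)%g (src1 x), (phi2 * phi1)%g (src2 x), (phi2 * phi1)%g (tgt x))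
  -> (map_mx (cconj s1) T2 *m T1) x y = 1.
  move=> px; rewrite !permM => xy.
  have [z Tz] : exists z, T2 x z != 0.
    apply: contrapT => h0; move/unitarymxP: (topaut_unitary h2) => /matrixP/(_ x x).
    rewrite !mxE eqxx big1 => [/esym/eqP|z _]; first by rewrite oner_eq0.
    by case: (T2 x z =P 0) => [->|/eqP ?]; [rewrite mul0r | case: h0; exists z].
  have xz := topaut_supp h2 Tz; have pz := pinnedP h2 px xz.
  have zy : legs y = (phi1 (src1 z), phi1 (src2 z), phi1 (tgt z)).
    by rewrite xy; case: xz => -> -> ->.
  rewrite mxE (bigD1 z) //= mxE (topaut_pinned h2 px xz) (topaut_pinned h1 pz zy).
  rewrite rmorph1 mulr1 big1 ?addr0 // => z' nz; rewrite mxE.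
  have [->|/eqP/(topaut_supp h2) xz'] := T2 x z' =P 0; first by rewrite rmorph0 mul0r.
  by case/eqP: nz; apply/esym/(pinned_uniq pz); rewrite xz xz'.
split.
- by rewrite permM (topaut_vac h2) (topaut_vac h1).
- by rewrite permM (topaut_psi h2) (topaut_psi h1).
- by move=> x y /supp[z [[e1 e2 e3] ->]]; rewrite e1 e2 e3 !permM.
- by rewrite mul_unitarymx ?map_cconj_unitary ?(topaut_unitary h1) ?(topaut_unitary h2).
- rewrite -tensmx_mul -map_mxT -mulmxA (topaut_F h1) mulmxA -map_mxM (topaut_F h2).
  by rewrite map_mxM map_cconjD mulmxA.
- rewrite -mulmxA (topaut_R h1) mulmxA -map_mxM (topaut_R h2).
  by rewrite map_mxM map_cconjD mulmxA.
- by move=> x y px; apply: pin; case: px => ?; [apply: Or31 | apply: Or32].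
- move=> x px; apply: pin; first exact: Or33.
  rewrite px; case: px => -> -> ->.
  by rewrite !permM (topaut_vac h2) (topaut_vac h1) (topaut_psi h2) (topaut_psi h1).
Qed.

Lemma is_topautV phi s T :
  is_topaut phi s T -> is_topaut phi^-1%g s (map_mx (cconj s) (T ^t*)).
Proof.
move=> h.
have eqV n (X : 'M[C]_n) (A : 'M[C]_n) : X \is unitarymx ->
    X *m A = map_mx (cconj s) A *m X ->
    map_mx (cconj s) (X ^t*) *m A = map_mx (cconj s) A *m map_mx (cconj s) (X ^t*).
  move=> uX XA; rewrite -[A in LHS](map_cconjK s) -!map_mxM; congr map_mx.
  have /unitarymxP X1 := uX.
  by rewrite -[map_mx _ A]mulmx1 -X1 [map_mx _ A *m _]mulmxA -XA !mulmxA unitarymxV ?mul1mx.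
have supp x y : legs x = (phi (src1 y), phi (src2 y), phi (tgt y)) ->
  legs y = (phi^-1%g (src1 x), phi^-1%g (src2 x), phi^-1%g (tgt x)).
  by case=> -> -> ->; rewrite !permK.
have suppV x y : legs y = (phi^-1%g (src1 x), phi^-1%g (src2 x), phi^-1%g (tgt x)) ->
  legs x = (phi (src1 y), phi (src2 y), phi (tgt y)).
  by case=> -> -> ->; rewrite !permKV.
have p0 : phi^-1%g (vac B) = vac B by rewrite -[in LHS](topaut_vac h) permK.
split=> //.
- by rewrite -[in LHS](topaut_psi h) permK.
- move=> x y; rewrite !mxE !fmorph_eq0 => /(topaut_supp h); exact: supp.
- by rewrite map_cconj_unitary ?trmxC_unitary ?(topaut_unitary h).
- rewrite -map_mxT -tens_trC; apply: eqV; last exact: topaut_F h.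
  exact/tens_unitary/(topaut_unitary h).
- apply: eqV; [exact: topaut_unitary h | exact: topaut_R h].
- move=> x y px xy; rewrite !mxE (topaut_unit h) ?rmorph1 //; last exact: suppV.
  by case: xy => -> ->; case: px => ->; rewrite p0; auto.
- by move=> x px; rewrite !mxE (topaut_psipsi h) ?rmorph1.
Qed.

Definition topaut1 : topaut B := mk_topaut is_topaut1.
(* al be is the composite "al after be" *)
Definition topautM al be : topaut B :=
  mk_topaut (is_topautM (topautP al) (topautP be)).
Definition topautV al : topaut B := mk_topaut (is_topautV (topautP al)).

Lemma topaut_eq al be : aut_perm al = aut_perm be -> aut_anti al = aut_anti be ->
  aut_mx al = aut_mx be -> al = be.
Proof.
case: al be => [[[p1 s1] T1] h1] [[[p2 s2] T2] h2]; rewrite /aut_perm /aut_anti /aut_mx /=.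
by move=> e1 e2 e3; apply: val_inj => /=; rewrite e1 e2 e3.
Qed.

Lemma topautMA : associative topautM.
Proof.
move=> x y z; apply: topaut_eq; rewrite /aut_perm /aut_anti /aut_mx /=.
- by rewrite mulgA.
- by rewrite addbA.
- by rewrite map_mxM map_cconjD mulmxA.
Qed.
Lemma topaut1M : left_id topaut1 topautM.
Proof.
move=> x; apply: topaut_eq; rewrite /aut_perm /aut_anti /aut_mx /= ?mulg1 //.
by rewrite mulmx1; apply/matrixP=> i j; rewrite mxE.
Qed.
Lemma topautM1 : right_id topaut1 topautM.
Proof.
move=> x; apply: topaut_eq; rewrite /aut_perm /aut_anti /aut_mx /= ?mul1g ?addbF //.
by rewrite map_mx1 mul1mx.
Qed.
Lemma topautVM : left_inverse topaut1 topautV topautM.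
Proof.
move=> x; have h := topaut_unitary (topautP x).
apply: topaut_eq; rewrite /aut_perm /aut_anti /aut_mx /= ?mulgV ?addbb //.
rewrite -map_mxM; move/unitarymxP: h; rewrite /aut_mx /= => ->; exact: map_mx1.
Qed.
Lemma topautMV : right_inverse topaut1 topautV topautM.
Proof.
move=> x; have h := topaut_unitary (topautP x).
apply: topaut_eq; rewrite /aut_perm /aut_anti /aut_mx /= ?mulVg ?addbb //.
by rewrite map_cconjK unitarymxV.
Qed.

HB.instance Definition _ := isGroup.Build (topaut B)
  topautMA topaut1M topautM1 topautVM topautMV.
End TopAutGroup.

Section Locality.
Variable B : fubfc.
Implicit Types (g : label B -> C) (al be : topaut B).

(* gamma_1 = 1, since the vacuum vertices are fixed *)
Definition natural g : Prop := (forall a, `|g a| = 1) /\ g (vac B) = 1.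

Definition vertex_factor g (x : 'I_(nv B)) : C := g (src1 x) * g (src2 x) / g (tgt x).

Definition nat_mx g : 'M[C]_(nv B) := diag_mx (\row_x vertex_factor g x).

Definition respects_locality al : Prop :=
  exists g, [/\ natural g, g (psi B) = 1 & val al = (1%g, false, nat_mx g)].

Lemma natural_neq0 g a : natural g -> g a != 0.
Proof. by case=> h _; rewrite -normr_eq0 h oner_eq0. Qed.

Lemma vertex_factor_unit g x : natural g -> vertex_factor g x * (vertex_factor g x)^* = 1.
Proof.
by case=> h _; rewrite -normCK /vertex_factor !normrM normfV !h mulr1 invr1 mulr1 expr1n.
Qed.

Lemma tens_diag (d : 'rV[C]_(nv B)) i j k l :
  (diag_mx d *t diag_mx d) (mxtens_index (i, j)) (mxtens_index (k, l)) =
  (d 0 i * d 0 j) *+ ((i == k) && (j == l)).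
Proof.
by rewrite tensmxE !mxE mulrnAr mulrnAl -mulrnA mulnb andbC.
Qed.

Lemma is_topaut_nat g : natural g -> g (psi B) ^+ 2 = 1 ->
  is_topaut (1%g : {perm label B}) false (nat_mx g).
Proof.
move=> ng g2; have cf n (A : 'M[C]_n) : map_mx (cconj false) A = A.
  by apply/matrixP=> i j; rewrite mxE.
have n0 a : g a != 0 by apply: natural_neq0.
split; rewrite ?perm1 //.
- move=> x y; rewrite !mxE !perm1; case: (x =P y) => [->//|_]; by rewrite eqxx.
- apply/unitarymxP; apply/matrixP=> x y.
  rewrite mul_diag_mx !mxE; case: (y =P x) => [->|nyx].
    by rewrite eqxx mulr1n vertex_factor_unit.
  by rewrite rmorph0 mulr0; case: (x =P y) => // e; case: nyx.
- rewrite cf.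
  have -> : nat_mx g *t nat_mx g = diag_mx (\row_i
      (vertex_factor g (mxtens_unindex i).1 * vertex_factor g (mxtens_unindex i).2)).
    apply/matrixP=> i j; case: (mxtens_indexP i) => i0 i1; case: (mxtens_indexP j) => j0 j1.
    by rewrite tens_diag !mxE !mxtens_indexK (can_eq (@mxtens_indexK _ _)) xpair_eqE.
  apply/matrixP=> i j; case: (mxtens_indexP i) => x y; case: (mxtens_indexP j) => z w.
  rewrite mul_diag_mx mul_mx_diag !mxE !mxtens_indexK /=.
  have [->|/eqP F0] := Fmx B (mxtens_index (x, y)) (mxtens_index (z, w)) =P 0.
    by rewrite mulr0 mul0r.
  rewrite mulrC; congr (_ * _).
  have [/eqP e1 /eqP e2 [e3 e4 e5 e6]] := F_supp (ubfcP B) F0.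
  rewrite /vertex_factor e1 e2 e3 e4 e5 e6.
  have := n0 (src1 y); have := n0 (src2 w); have := n0 (tgt w).
  by move=> ? ? ?; field; apply/and3P.
- rewrite cf; apply/matrixP=> x y; rewrite mul_diag_mx mul_mx_diag !mxE.
  have [->|/eqP R0] := Rmx B x y =P 0; first by rewrite mulr0 mul0r.
  have [e1 e2 e3] := R_supp (ubfcP B) R0.
  by rewrite mulrC /vertex_factor e1 e2 e3 [g (src2 x) * _]mulrC.
- move=> x y px; rewrite !perm1 => xy.
  rewrite (@pinned_uniq B x y) ?xy //; last by case: px => ?; [apply: Or31 | apply: Or32].
  rewrite !mxE eqxx mulr1n /vertex_factor; case: ng => _ g1.
  have P := ubfcP B.
  have : (0 < fus (src1 y) (src2 y) (tgt y))%N by apply/card_gt0P; exists y; rewrite inE.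
  have {px} : src1 y = vac B \/ src2 y = vac B.
    case: xy px => -> -> _ [] ->; auto.
  case=> ->; rewrite ?(fus1l P) ?(fus1r P) lt0b => /eqP ->; rewrite g1 ?mul1r ?mulr1; exact: divff.
- by move=> x [e1 e2 e3]; rewrite !mxE eqxx mulr1n /vertex_factor e1 e2 e3; case: ng => _ ->;
    rewrite divr1 -expr2.
Qed.

Lemma respects_localityF al be : respects_locality al -> respects_locality be ->
  respects_locality (al / be)%g.
Proof.
case: al => [[[p1 s1] T1] h1] [g1 [n1 q1 /= [e1 e1' e1'']]].
case: be => [[[p2 s2] T2] h2] [g2 [n2 q2 /= [e2 e2' e2'']]]; subst.
exists (fun a => g1 a / g2 a); split.
- split=> [a|]; first by rewrite normrM normfV n1.1 n2.1 invr1 mulr1.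
  by rewrite n1.2 n2.2 divr1.
- by rewrite q1 q2 divr1.
rewrite /= /aut_perm /aut_anti /aut_mx /= invg1 mulg1; congr (_, _, _).
apply/matrixP=> x y; rewrite mul_mx_diag !mxE /=.
case: (x =P y) => [->|nxy]; last first.
  by case: (y =P x) => [e|_]; [case: nxy | rewrite rmorph0 mul0r].
rewrite eqxx !mulr1n.
have -> : (vertex_factor g2 y)^* = (vertex_factor g2 y)^-1.
  have u := vertex_factor_unit y n2.
  have u0 : vertex_factor g2 y != 0 by apply: contra_eq_neq u => ->; rewrite mul0r eq_sym oner_eq0.
  by apply: (mulfI u0); rewrite u divff.
have n0 := natural_neq0 _ n1; have n0' := natural_neq0 _ n2.
rewrite /vertex_factor.
have := n0 (tgt y); have := n0' (tgt y); have := n0' (src1 y); have := n0' (src2 y).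
by move=> ? ? ? ?; field; do !(apply/andP; split).
Qed.

Lemma respects_localityJ al be : respects_locality al ->
  respects_locality (be^-1 * (al * be))%g.
Proof.
move=> [g [n q e]]; have hb := topautP be.
have e1 : aut_perm al = 1%g by rewrite /aut_perm e.
have e2 : aut_anti al = false by rewrite /aut_anti e.
have e3 : aut_mx al = nat_mx g by rewrite /aut_mx e.
exists (fun a => cconj (aut_anti be) (g (aut_perm be a))); split.
- split=> [a|]; last by rewrite (topaut_vac hb) n.2 rmorph1.
  by rewrite /cconj; case: aut_anti; rewrite ?norm_conjC n.1.
- by rewrite (topaut_psi hb) q rmorph1.
transitivity ((1%g : {perm label B}), false, map_mx (cconj (aut_anti be))
    (map_mx (cconj false) (aut_mx be) *m nat_mx g) *m map_mx (cconj (aut_anti be)) (aut_mx be ^t*)).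
  transitivity ((aut_perm be * aut_perm al)%g * (aut_perm be)^-1,
    aut_anti be (+) (aut_anti al (+) aut_anti be), map_mx (cconj (aut_anti be))
    (map_mx (cconj (aut_anti al)) (aut_mx be) *m aut_mx al) *m
    map_mx (cconj (aut_anti be)) (aut_mx be ^t* ))%g; last first.
    by rewrite e1 e2 e3 mulg1 mulgV addFb addbb.
  by [].
congr (_, _, _).
have -> : map_mx (cconj false) (aut_mx be) *m nat_mx g =
          nat_mx (fun a => g (aut_perm be a)) *m aut_mx be.
  apply/matrixP=> x y; rewrite mul_diag_mx mul_mx_diag !mxE.
  have [->|/eqP T0] := aut_mx be x y =P 0; first by rewrite mulr0 mul0r.
  by have [f1 f2 f3] := topaut_supp hb T0; rewrite mulrC /vertex_factor f1 f2 f3.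
rewrite -map_mxM -mulmxA; have /unitarymxP -> := topaut_unitary hb.
rewrite mulmx1; apply/matrixP=> x y; rewrite !mxE rmorphMn /=; congr (_ *+ _).
by rewrite /vertex_factor !rmorphM fmorphV.
Qed.

Definition local_natural : normalSubgroup (topaut B).
Proof.
refine (@NormalSubgroup _ (fun al => `[< respects_locality al >]) _ _ _).
- apply/asboolP; exists (fun=> 1); split=> //; first by split=> // a; rewrite normr1.
  rewrite /=; congr (_, _, _); apply/matrixP=> x y.
  by rewrite !mxE /vertex_factor mulr1 divr1.
- by move=> al be /asboolP ha /asboolP hb; apply/asboolP/respects_localityF.
- by move=> al be /asboolP ha; apply/asboolP/respects_localityJ.
Defined.

Definition AutLR := quotg local_natural.
HB.instance Definition _ := Group.on AutLR.

Definition bracket al : AutLR := cls local_natural al.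

Lemma bracketM al be : bracket (al * be)%g = (bracket al * bracket be)%g.
Proof. exact: clsM. Qed.

Lemma bracketP al be : bracket al = bracket be <-> respects_locality (al^-1 * be)%g.
Proof. by split=> [/clsP/asboolP|h] //; apply/clsP/asboolP. Qed.

Lemma bracket_repr (q : AutLR) : bracket (repr q) = q.
Proof. exact: cls_repr. Qed.

Definition antiunitary (q : AutLR) : bool := aut_anti (repr q).

Lemma antiunitary_bracket al : antiunitary (bracket al) = aut_anti al.
Proof.
have /bracketP[g [_ _ h]] := bracket_repr (bracket al).
move/(congr1 (fun p => p.1.2)): h; rewrite /= -/(antiunitary (bracket al)).
rewrite [X in X = _ -> _](_ : _ = antiunitary (bracket al) (+) aut_anti al) //.
by case: (antiunitary _); case: (aut_anti al).
Qed.

Definition upsilon_fun (a : label B) : C := if a == psi B then -1 else 1.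

Lemma upsilon_natural : natural upsilon_fun.
Proof.
rewrite /natural /upsilon_fun; split=> [a|].
  by case: ifP; rewrite ?normrN normr1.
by rewrite eq_sym (negPf (psi_neq_vac B)).
Qed.

Definition Upsilon : topaut B.
Proof.
apply: (mk_topaut (@is_topaut_nat upsilon_fun upsilon_natural _)).
by rewrite /upsilon_fun eqxx sqrrN expr1n.
Defined.
End Locality.

Section FusionRing.
Variables (B : skeleton) (P : is_ubfc B).
Implicit Types (a b c : label B).

Lemma fusE a b c : fus a b c = (\sum_(x | legs x == (a, b, c)) 1)%N.
Proof. by rewrite /fus -sum1_card; apply: eq_bigl => x; rewrite inE. Qed.

Lemma fusC a b c : fus a b c = fus b a c.
Proof.
have R1 x : \sum_y Rmx B x y * (Rmx B x y)^* = 1.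
  have /unitarymxP/matrixP/(_ x x) := R_unit P.
  by rewrite !mxE eqxx => e; apply: etrans e; apply: eq_bigr => y _; rewrite !mxE.
have R2 y : \sum_x Rmx B x y * (Rmx B x y)^* = 1.
  have /matrixP/(_ y y) := unitarymxV (R_unit P).
  by rewrite !mxE eqxx => e; apply: etrans e; apply: eq_bigr => x _; rewrite !mxE mulrC.
apply/eqP; rewrite -(eqr_nat C) !fusE !natr_sum.
pose G x y := Rmx B x y * (Rmx B x y)^*.
have G0 x y : legs y != (src2 x, src1 x, tgt x) -> G x y = 0.
  rewrite /G; have [->|/eqP/(R_supp P) ->] := Rmx B x y =P 0; first by rewrite mul0r.
  by rewrite eqxx.
rewrite (eq_bigr (fun x => \sum_(y | legs y == (b, a, c)) G x y)); last first.
  move=> x /eqP[<- <- <-]; rewrite -(R1 x) [LHS](bigID (fun y => legs y == (src2 x, src1 x, tgt x))) /=.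
  by rewrite [X in _ + X]big1 ?addr0 // => y /G0.
rewrite exchange_big /=; apply/eqP/eq_bigr => y /eqP[e1 e2 e3].
rewrite -(R2 y) [RHS](bigID (fun x => legs x == (a, b, c))) /=.
rewrite [X in _ + X]big1 ?addr0 // => x; rewrite -/(G x y) => nx; apply: G0.
by apply: contraNneq nx => -[]; rewrite /legs -e1 -e2 -e3 => -> -> ->.
Qed.

Lemma dualK : involutive (@dual B).
Proof.
move=> a; have : fus a (dual a) (vac B) = true by rewrite (fus_dual P) eqxx.
by rewrite fusC (fus_dual P); case: eqP.
Qed.

Lemma fus_rot a b c : fus a b c = fus b (dual c) (dual a).
Proof.
have := fusA P a b (dual c) (vac B).
rewrite (bigD1 c) //= (fus_dual P) eqxx muln1 big1 ?addn0; last first.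
  by move=> e ne; rewrite (fus_dual P) (can_eq dualK) eq_sym (negPf ne) muln0.
move=> ->; rewrite (bigD1 (dual a)) //= (fus_dual P) eqxx muln1 big1 ?addn0 //.
by move=> e ne; rewrite (fus_dual P) (negPf ne) muln0.
Qed.

Lemma fus_frob a b c : fus a b c = fus (dual a) c b.
Proof. by rewrite -(fus_dualM P) fus_rot !dualK. Qed.

Definition character (d : label B -> C) : Prop :=
  (forall a, 0 < d a) /\
  (forall a b, d a * d b = \sum_c (fus a b c)%:R * d c).

Lemma character_dual d d' : character d -> character d' ->
  forall a, d a = d' (dual a).
Proof.
move=> [d0 dM] [d0' dM'] a; pose S := \sum_b d' b * d b.
have S0 : S != 0.
  rewrite gt_eqF // /S (bigD1 (vac B)) //= ltr_wpDr ?mulr_gt0 //.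
  by apply: sumr_ge0 => b _; rewrite mulr_ge0 ?ltW.
apply: (mulIf S0); rewrite /S !mulr_sumr.
transitivity (\sum_b \sum_c d' b * (fus a b c)%:R * d c).
  by apply: eq_bigr => b _; rewrite mulrCA dM mulr_sumr; apply: eq_bigr => c _; rewrite mulrA.
rewrite exchange_big /=; apply: eq_bigr => c _.
rewrite mulrA dM' mulr_suml; apply: eq_bigr => b _.
by rewrite fus_frob [d' b * _]mulrC.
Qed.

Lemma character_uniq d d' : character d -> character d' -> d =1 d'.
Proof.
by move=> h h' a; rewrite (character_dual h h) (character_dual h h') dualK.
Qed.

Lemma qdim_character : character (@qdim B).
Proof. by split; [exact: qdim_gt0 | exact: qdimM]. Qed.

Lemma qdim_dual a : qdim (dual a) = qdim a.
Proof. by rewrite [RHS](character_dual qdim_character qdim_character). Qed.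

Variable p : label B.
Definition cent a : bool := `[< braids_trivially p a >].

Lemma centP a : reflect
  (forall x y, src1 x = p -> src2 x = a -> Rmx B x y = (Rmx B)^t* x y) (cent a).
Proof.
have U := R_unit P.
have RV : Rmx B *m (Rmx B)^t* = 1%:M by apply/unitarymxP.
rewrite /cent; apply: (iffP (asboolP _)) => h x y h1 h2.
- have e : row x (Rmx B *m Rmx B) = row x 1%:M.
    by apply/rowP => j; rewrite mxE h // !mxE.
  have : row x (Rmx B *m Rmx B *m (Rmx B)^t*) = row x ((Rmx B)^t*).
    by rewrite row_mul e -row_mul mul1mx.
  by rewrite -mulmxA RV mulmx1 => /rowP/(_ y); rewrite [LHS]mxE [RHS]mxE.
- have := unitarymxV U => /matrixP/(_ x y); rewrite [LHS]mxE [RHS]mxE => e.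
  by apply: etrans e; rewrite mxE; apply: eq_bigr => z _; rewrite h.
Qed.

Lemma trC_supp x y : (Rmx B)^t* x y != 0 -> legs y = (src2 x, src1 x, tgt x).
Proof.
by rewrite !mxE conjC_eq0 => /(R_supp P)[-> -> ->].
Qed.

Lemma cent_fus a b c : cent a -> cent b -> fus a b c != 0%N -> cent c.
Proof.
move=> /centP ha /centP hb; rewrite -lt0n => /card_gt0P[z0]; rewrite inE => /eqP[z1 z2 z3].
apply/centP => w0 w1 e1 e2; apply/eqP; rewrite -subr_eq0; apply/eqP.
pose D := Rmx B - (Rmx B)^t*.
have DE x y : D x y = Rmx B x y - (Rmx B)^t* x y by rewrite /D mxE [in X in _ + X]mxE.
rewrite -DE.
have Fext (x y z w : 'I_(nv B)) : Fsym x y z w != 0 ->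
    [/\ src1 x = src1 w, src2 x = src1 z & src2 y = src2 z].
  by move=> nF; have [_ _ [-> -> -> _]] := F_supp P nF.
have H x y u v : src1 x = p -> src2 x = a -> src2 y = b ->
    \sum_z \sum_w Fsym x y z w * (\sum_t D w t * Fsym z t u v) = 0.
  move=> x1 x2 y2.
  have : \sum_s \sum_t Rmx B x s * Fsym s y t v * Rmx B t u =
         \sum_s \sum_t (Rmx B)^t* x s * Fsym s y t v * (Rmx B)^t* t u.
    apply: eq_bigr => s _; apply: eq_bigr => t _.
    rewrite ha //; have [->|/eqP nR] := (Rmx B)^t* x s =P 0; first by rewrite !mul0r.
    have [->|/eqP nF] := Fsym s y t v =P 0; first by rewrite mulr0 !mul0r.
    have [_ f1 f2] := Fext _ _ _ _ nF; have [_ f3 _] := trC_supp nR.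
    by rewrite hb // -?f1 -?f2 ?f3.
  rewrite -(R_hexagon P) -(R_hexagonV P) => /eqP; rewrite -subr_eq0 => /eqP e.
  apply: etrans e; rewrite -sumrB; apply: eq_bigr => z _; rewrite -sumrB; apply: eq_bigr => w _.
  rewrite -sumrB mulr_sumr; apply: eq_bigr => t _.
  by rewrite DE mulrBl mulrBr !mulrA.

have H1 u v : \sum_t D w0 t * Fsym z0 t u v = 0.
  have [rt|nrt] := boolP (rtree z0 w0); last first.
    by move: nrt; rewrite /rtree z3 e2 eqxx.
  transitivity (\sum_x \sum_y (Fsym x y z0 w0)^* *
      \sum_z \sum_w Fsym x y z w * (\sum_t D w t * Fsym z t u v)); last first.
    apply: big1 => x _; apply: big1 => y _.
    have [->|/eqP nF] := Fsym x y z0 w0 =P 0; first by rewrite rmorph0 mul0r.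
    have [f1 f2 f3] := Fext _ _ _ _ nF.
    by rewrite H ?mulr0 ?f1 ?f2 ?f3.
  pose K z w := \sum_t D w t * Fsym z t u v.
  transitivity (\sum_z \sum_w ((z0 == z) && (w0 == w))%:R * K z w).
    rewrite [RHS](bigD1 z0) //= [X in _ + X]big1 => [|z nz]; last first.
      by apply: big1 => w _; rewrite eq_sym (negPf nz) mul0r.
    rewrite addr0 [RHS](bigD1 w0) //= !eqxx mul1r [X in _ + X]big1 ?addr0 // => w nw.
    by rewrite [w0 == w]eq_sym (negPf nw) mul0r.
  transitivity (\sum_z \sum_w (\sum_x \sum_y (Fsym x y z0 w0)^* * Fsym x y z w) * K z w).
    apply: eq_bigr => z _; apply: eq_bigr => w _.
    have [rzw|nzw] := boolP (rtree z w); first by rewrite (F_unitr P).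
    rewrite [X in _ = X * _]big1 => [|x _].
      have -> : (z0 == z) && (w0 == w) = false; last by rewrite !mul0r.
      by apply: contraNF nzw => /andP[/eqP <- /eqP <-].
    apply: big1 => y _; have [->|/eqP/(F_supp P)[_]] := Fsym x y z w =P 0.
      by rewrite mulr0.
    by rewrite (negPf nzw).
  under eq_bigr => z _.
    under eq_bigr => w _.
      rewrite mulr_suml; under eq_bigr => x _ do rewrite mulr_suml.
      over.
    rewrite exchange_big /=; under eq_bigr => x _ do rewrite exchange_big /=.
    over.
  rewrite exchange_big; apply: eq_bigr => x _.
  rewrite exchange_big; apply: eq_bigr => y _.
  rewrite mulr_sumr; apply: eq_bigr => z _; rewrite mulr_sumr.
  by apply: eq_bigr => w _; rewrite mulrA.
have [D0|/eqP nD] := D w0 w1 =P 0; first by [].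
have w01 : src1 w1 = c.
  have [r|/eqP r] := Rmx B w0 w1 =P 0; last by have [-> _ _] := R_supp P r.
  have [r'|/eqP r'] := (Rmx B)^t* w0 w1 =P 0; last by have [-> _ _] := trC_supp r'.
  by case/eqP: nD; rewrite DE r r' subr0.
have l1 : ltree z0 w1 by rewrite /ltree z3 w01.
transitivity (\sum_u \sum_v (Fsym z0 w1 u v)^* * \sum_t D w0 t * Fsym z0 t u v); last first.
  by apply: big1 => u _; apply: big1 => v _; rewrite H1 mulr0.
transitivity (\sum_t D w0 t * \sum_u \sum_v Fsym z0 t u v * (Fsym z0 w1 u v)^* ).
  rewrite (bigD1 w1) //= (F_unitl P) // !eqxx mulr1 big1 ?addr0 // => t nt.
  have [lt|nlt] := boolP (ltree z0 t).
    by rewrite (F_unitl P) // (negPf nt) andbF mulr0.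
  rewrite big1 ?mulr0 // => u _; apply: big1 => v _.
  have [->|/eqP/(F_supp P)[]] := Fsym z0 t u v =P 0; first by rewrite mul0r.
  by rewrite (negPf nlt).
under eq_bigr => t _.
  rewrite mulr_sumr; under eq_bigr => u _ do rewrite mulr_sumr.
  over.
rewrite exchange_big; apply: eq_bigr => u _; rewrite exchange_big; apply: eq_bigr => v _.
by rewrite mulr_sumr; apply: eq_bigr => t _; rewrite [RHS]mulrC mulrA.
Qed.

Local Notation d := (@qdim B).

Lemma cent_grade a b c : cent a -> cent c -> ~~ cent b -> fus a b c = 0%N.
Proof.
move=> ca cc ncb; rewrite fus_frob.
have d0 : forall x, 0 < d x by exact: (qdim_gt0 P).
pose D0 := \sum_(x | cent x) d x ^+ 2.
pose G x y := d x * (fus (dual a) x y)%:R * d y.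
have G0 x y : 0 <= G x y by rewrite /G !mulr_ge0 ?ler0n // ltW.
have tot : \sum_(x | cent x) \sum_y G x y = d a * D0.
  rewrite mulr_sumr; apply: eq_bigr => x _.
  rewrite -(qdim_dual a) expr2 mulrA (qdimM P) mulr_suml.
  by apply: eq_bigr => y _; rewrite /G -mulrA mulrC.
have tot1 : \sum_(x | cent x) \sum_(y | cent y) G x y = d a * D0.
  transitivity (\sum_(y | cent y) d y * (d a * d y)).
    rewrite exchange_big /=; apply: eq_bigr => y cy.
    rewrite (qdimM P) mulr_sumr [RHS](bigID cent) /= [X in _ = _ + X]big1 ?addr0.
      by apply: eq_bigr => x cx; rewrite /G -fus_frob; ring.
    move=> x nx; have [->|/eqP nf] := fus a y x =P 0%N; first by rewrite mul0r mulr0.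
    by move: nx; rewrite (cent_fus ca cy nf).
  by rewrite mulr_sumr; apply: eq_bigr => y _; rewrite expr2 mulrCA.
have : \sum_(x | cent x) \sum_(y | ~~ cent y) G x y = 0.
  apply: (addrI (\sum_(x | cent x) \sum_(y | cent y) G x y)).
  rewrite addr0 -big_split /= tot1 -tot; apply: eq_bigr => x _.
  by rewrite [RHS](bigID cent).
move/psumr_eq0P => /(_ _ c cc); rewrite -/(is_true _).
move=> h; have /psumr_eq0P : \sum_(y | ~~ cent y) G c y = 0.
  by apply: h => x _; apply: sumr_ge0.
move=> /(_ _ b ncb) => h'; have /eqP : G c b = 0 by apply: h' => *; exact: G0.
by rewrite /G !mulf_eq0 (gt_eqF (d0 c)) (gt_eqF (d0 b)) pnatr_eq0 orbF => /eqP.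
Qed.

Lemma cent_dim : (exists b, ~~ cent b) ->
  \sum_(a | cent a) qdim a ^+ 2 <= \sum_(a | ~~ cent a) (qdim a : C) ^+ 2.
Proof.
case=> b nb; have d0 : forall x, 0 < d x by exact: (qdim_gt0 P).
rewrite -(ler_pM2l (d0 b)).
have -> : d b * \sum_(a | cent a) d a ^+ 2 =
    \sum_(a | cent a) \sum_(c | ~~ cent c) d c * (fus b a c)%:R * d a.
  rewrite mulr_sumr; apply: eq_bigr => a ca; rewrite expr2 mulrA (qdimM P) mulr_suml.
  rewrite [LHS](bigID cent) /= big1 ?add0r => [|c cc].
    by apply: eq_bigr => c _; rewrite [_ * d c]mulrC.
  by rewrite fusC cent_grade // !mul0r.
rewrite exchange_big /= mulr_sumr; apply: ler_sum => c nc.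
apply: (@le_trans _ _ (\sum_a d c * (fus b a c)%:R * d a)).
  rewrite [leRHS](bigID cent) /= lerDl; apply: sumr_ge0 => a _.
  by rewrite !mulr_ge0 ?ler0n // ltW.
have -> : d b * d c ^+ 2 = d c * (d (dual b) * d c) by rewrite qdim_dual; ring.
rewrite (qdimM P) mulr_sumr; apply: ler_sum => a _.
by rewrite -fus_frob mulrA.
Qed.
End FusionRing.

Lemma mulmx_sub n n' m m' p' (f : 'I_n' -> 'I_n) (i : 'I_m' -> 'I_m)
    p (k : 'I_p' -> 'I_p) (A : 'M[C]_(m, n)) (A' : 'M[C]_(n, p)) :
  injective f -> (forall x z, A (i x) z != 0 -> z \in codom f) ->
  mxsub i k (A *m A') = mxsub i f A *m mxsub f k A'.
Proof.
move=> finj h; apply/matrixP=> x y; rewrite !mxE.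
rewrite (bigID (fun z => z \in codom f)) /= [X in _ + X]big1 ?addr0.
  rewrite (eq_bigl (fun z => z \in [set f t | t in [set: 'I_n']])); last first.
    by move=> z; apply/codomP/imsetP => -[t]; [move=> ->; exists t | move=> _ ->; exists t].
  rewrite big_imset /=; last by move=> ? ? _ _; exact: finj.
  by apply: eq_big => [t|t _]; rewrite ?inE ?mxE.
by move=> z nz; have [->|/eqP/h] := A (i x) z =P 0; rewrite ?mul0r // (negPf nz).
Qed.

Section Restriction.
Variables (B D : fubfc) (sB : super_modular B) (E : min_mod_ext B D).
Notation emb := (emb E).
Notation vemb := (vemb E).
Let PB := ubfcP B.
Let PD := ubfcP D.

Lemma vemb_codom y : src1 y \in codom emb -> src2 y \in codom emb ->
  exists x, y = vemb x.
Proof. by move=> h1 h2; apply/codomP/(vemb_full h1 h2). Qed.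

Lemma R_codom x y : Rmx D (vemb x) y != 0 -> y \in codom vemb.
Proof.
move=> /(R_supp PD)[h1 h2 _]; have [e1 e2 _] := legs_vemb E x.
by apply: vemb_full; rewrite ?h1 ?h2 ?e1 ?e2 codom_f.
Qed.

Lemma sub_R : mxsub vemb vemb (Rmx D) = Rmx B.
Proof. by apply/matrixP=> x y; rewrite mxE emb_R. Qed.

Lemma emb_cent a : cent (psi D) (emb a).
Proof.
apply/asboolP => y y' h1 h2.
have [||x ex] := @vemb_codom y; rewrite ?h1 ?h2 -?(emb_psi E) ?codom_f //.
have [e1 e2 _] := legs_vemb E x; subst y.
have [x1 x2] : src1 x = psi B /\ src2 x = a.
  by split; apply: (emb_inj (m := E)); [rewrite -e1 h1 emb_psi | rewrite -e2].
have [/codomP[x' ->]|ny'] := boolP (y' \in codom vemb).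
  have := mulmx_sub vemb (Rmx D) (@vemb_inj _ _ E) R_codom.
  move=> /matrixP/(_ x x'); rewrite mxE => ->; rewrite sub_R.
  by rewrite ((sB (psi B)).2 (or_intror erefl) a x x' x1 x2) (inj_eq (@vemb_inj _ _ E)).
rewrite mxE big1 => [|z _].
  by case: eqP => // e; rewrite -e codom_f in ny'.
have [->|/eqP/R_codom/codomP[z' ->]] := Rmx D (vemb x) z =P 0; first by rewrite mul0r.
have [->|/eqP/R_codom] := Rmx D (vemb z') y' =P 0; first by rewrite mulr0.
by rewrite (negPf ny').
Qed.

Lemma fus_emb a b c : fus (emb a) (emb b) (emb c) = fus a b c.
Proof.
rewrite /fus -(card_imset _ (@vemb_inj _ _ E)); congr #|pred_of_set _|.
apply/setP => y; rewrite inE; apply/eqP/imsetP => [[h1 h2 h3]|[x]].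
  have [||x ex] := @vemb_codom y; rewrite ?h1 ?h2 ?codom_f //; subst y.
  exists x => //; have [e1 e2 e3] := legs_vemb E x; rewrite inE.
  by rewrite /legs; apply/eqP; congr (_, _, _); apply: (@emb_inj _ _ E);
    rewrite -?e1 -?e2 -?e3.
by rewrite inE => /eqP[<- <- <-] ->; rewrite legs_vemb.
Qed.

Lemma fus_emb0 a b c : c \notin codom emb -> fus (emb a) (emb b) c = 0%N.
Proof.
move=> nc; apply/eqP; rewrite cards_eq0 -subset0; apply/subsetP => y.
rewrite inE => /eqP[h1 h2 h3]; case/negP: nc.
have [||x ex] := @vemb_codom y; rewrite ?h1 ?h2 ?codom_f //; subst y.
by rewrite -h3; have [_ _ ->] := legs_vemb E x; rewrite codom_f.
Qed.

Lemma sum_codom (F : label D -> C) :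
  \sum_(a | a \in codom emb) F a = \sum_b F (emb b).
Proof.
rewrite (eq_bigl (fun z => z \in [set emb t | t in [set: label B]])); last first.
  by move=> z; apply/codomP/imsetP => -[t]; [move=> ->; exists t | move=> _ ->; exists t].
rewrite big_imset /=; last by move=> ? ? _ _; exact: emb_inj.
by apply: eq_bigl => t; rewrite inE.
Qed.

Lemma qdim_emb a : qdim (emb a) = qdim a.
Proof.
suff h : character (fun a : label B => qdim (emb a)).
  exact: (character_uniq PB h (qdim_character PB)).
split=> [b|b c]; first exact: qdim_gt0.
rewrite (qdimM PD) (bigID (fun z => z \in codom emb)) /= sum_codom [X in _ + X]big1 ?addr0.
  by apply: eq_bigr => e _; rewrite fus_emb.
by move=> e ne; rewrite fus_emb0 // mul0r.
Qed.

Lemma cent_codom a : cent (psi D) a -> a \in codom emb.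
Proof.
move=> ca; apply/negP => /negP na.
have nB : exists b, ~~ cent (psi D) b.
  apply: contrapT => h; have : transparent (psi D).
    by move=> b; apply/asboolP/negP => /negP nb; apply: h; exists b.
  by move/(ext_modular E)/eqP; rewrite (negPf (psi_neq_vac D)).
pose D0 := \sum_(b | cent (psi D) b) (qdim b : C) ^+ 2.
pose D1 := \sum_(b | ~~ cent (psi D) b) (qdim b : C) ^+ 2.
have h01 : D0 <= D1 := cent_dim PD nB.
pose DE := \sum_(b | cent (psi D) b && (b \notin codom emb)) (qdim b : C) ^+ 2.
have dim2 (b : label D) : 0 <= (qdim b : C) ^+ 2.
  by apply: exprn_ge0; apply: ltW; apply: (qdim_gt0 PD).
have D0E : D0 = total_dim2 B + DE.
  rewrite /D0 (bigID (fun z => z \in codom emb)) /=; congr (_ + _).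
  rewrite (eq_bigl (fun z => z \in codom emb)) => [|z].
    by rewrite sum_codom; apply: eq_bigr => b _; rewrite qdim_emb.
  by apply: andb_idl => /codomP[b ->]; exact: emb_cent.
have DT : D0 + D1 = 2%:R * total_dim2 B.
  by rewrite -(ext_dim E) /total_dim2 [RHS](bigID (cent (psi D))).
have : DE <= 0.
  have e2 : DE *+ 2 = D0 - D1.
    have -> : D1 = 2%:R * total_dim2 B - D0 by rewrite -DT; ring.
    by rewrite D0E; ring.
  by rewrite -(pmulrn_lle0 _ (isT : (0 < 2)%N)) e2 subr_le0.
apply/negP; rewrite lt_geF // /DE (bigD1 a) /= ?ca //.
rewrite ltr_wpDr //; last by apply: exprn_gt0; apply: (qdim_gt0 PD).
by apply: sumr_ge0 => b _; exact: dim2.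
Qed.

Lemma topaut_cent (al : topaut D) a : cent (psi D) a -> cent (psi D) (aut_perm al a).
Proof.
move=> /asboolP ca; apply/asboolP => y z h1 h2; have h := topautP al.
pose M := Rmx D *m Rmx D.
have TM : aut_mx al *m M = map_mx (cconj (aut_anti al)) M *m aut_mx al.
  by rewrite /M mulmxA (topaut_R h) -mulmxA (topaut_R h) mulmxA -map_mxM.
have TT := unitarymxV (topaut_unitary h).
have -> : Rmx D *m Rmx D = (aut_mx al) ^t* *m (map_mx (cconj (aut_anti al)) M *m aut_mx al).
  by rewrite -TM mulmxA TT mul1mx.
have <- : (1%:M : 'M[C]_(nv D)) y z = (y == z)%:R by rewrite mxE.
rewrite -TT [LHS]mxE [RHS]mxE; apply: eq_bigr => x _.
have [->|/eqP T0] := ((aut_mx al) ^t*) y x =P 0; first by rewrite !mul0r.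
congr (_ * _); move: T0; rewrite !mxE conjC_eq0 => /(topaut_supp h)[e1 e2 _].
have x1 : src1 x = psi D.
  by apply: (@perm_inj _ (aut_perm al)); rewrite -e1 h1 (topaut_psi h).
have x2 : src2 x = a by apply: (@perm_inj _ (aut_perm al)); rewrite -e2 h2.
rewrite (bigD1 x) //= [X in X * _]mxE ca // eqxx rmorph1 mul1r big1 ?addr0 // => w nw.
by rewrite [X in X * _]mxE ca // eq_sym (negPf nw) rmorph0 mul0r.
Qed.

Lemma topaut_emb (al : topaut D) a : aut_perm al (emb a) \in codom emb.
Proof. exact/cent_codom/topaut_cent/emb_cent. Qed.

Definition restr_label (al : topaut D) (a : label B) : label B :=
  iinv (topaut_emb al a).

Lemma restr_labelE al a : emb (restr_label al a) = aut_perm al (emb a).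
Proof. exact: f_iinv. Qed.

Lemma restr_label_inj al : injective (restr_label al).
Proof.
move=> a b ab; apply: (@emb_inj _ _ E); apply: (@perm_inj _ (aut_perm al)).
by rewrite -!restr_labelE ab.
Qed.

Definition restr_perm al : {perm label B} := perm (@restr_label_inj al).
Definition restr_mx (al : topaut D) : 'M[C]_(nv B) := mxsub vemb vemb (aut_mx al).

Lemma restr_permE al a : emb (restr_perm al a) = aut_perm al (emb a).
Proof. by rewrite permE restr_labelE. Qed.

Lemma topaut_codom al x y : aut_mx al (vemb x) y != 0 -> y \in codom vemb.
Proof.
move=> /(topaut_supp (topautP al))[h1 h2 _]; have [e1 e2 _] := legs_vemb E x.
by apply: vemb_full; rewrite ?h1 ?h2 ?e1 ?e2 -restr_permE codom_f.
Qed.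

Lemma legs_restr al x y :
  legs (vemb y) = (aut_perm al (src1 (vemb x)), aut_perm al (src2 (vemb x)), aut_perm al (tgt (vemb x)))
  <-> legs y = (restr_perm al (src1 x), restr_perm al (src2 x), restr_perm al (tgt x)).
Proof.
have [e1 e2 e3] := legs_vemb E x; rewrite legs_vemb e1 e2 e3 -!restr_permE.
by split=> [[/(@emb_inj _ _ E) h1 /(@emb_inj _ _ E) h2 /(@emb_inj _ _ E) h3]|[-> -> ->]] //;
  rewrite /legs h1 h2 h3.
Qed.

Lemma sub_unitary (T : 'M[C]_(nv D)) :
  (forall x y, T (vemb x) y != 0 -> y \in codom vemb) -> T \is unitarymx ->
  mxsub vemb vemb T \is unitarymx.
Proof.
move=> hT /unitarymxP uT; apply/unitarymxP.
have -> : (mxsub vemb vemb T) ^t* = mxsub vemb vemb (T ^t*).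
  by apply/matrixP=> x y; rewrite !mxE.
rewrite -(mulmx_sub _ _ (@vemb_inj _ _ E)) // uT.
by apply/matrixP=> x y; rewrite !mxE (inj_eq (@vemb_inj _ _ E)).
Qed.

Let vemb2 (i : 'I_(nv B * nv B)) : 'I_(nv D * nv D) :=
  mxtens_index (vemb (mxtens_unindex i).1, vemb (mxtens_unindex i).2).

Lemma vemb2E x y : vemb2 (mxtens_index (x, y)) = mxtens_index (vemb x, vemb y).
Proof. by rewrite /vemb2 mxtens_indexK. Qed.

Lemma vemb2_inj : injective vemb2.
Proof.
move=> i j; case: (mxtens_indexP i) => x y; case: (mxtens_indexP j) => z w.
rewrite !vemb2E => /(can_inj (@mxtens_indexK _ _)) [h1 h2].
by rewrite (vemb_inj h1) (vemb_inj h2).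
Qed.

Lemma vemb2_codom x y : x \in codom vemb -> y \in codom vemb ->
  mxtens_index (x, y) \in codom vemb2.
Proof.
by move=> /codomP[x' ->] /codomP[y' ->]; rewrite -vemb2E codom_f.
Qed.

Lemma sub_F : mxsub vemb2 vemb2 (Fmx D) = Fmx B.
Proof.
apply/matrixP=> i j; case: (mxtens_indexP i) => x y; case: (mxtens_indexP j) => z w.
by rewrite mxE !vemb2E; exact: emb_F.
Qed.

Lemma sub_tens (T : 'M[C]_(nv D)) :
  mxsub vemb2 vemb2 (T *t T) = mxsub vemb vemb T *t mxsub vemb vemb T.
Proof.
apply/matrixP=> i j; case: (mxtens_indexP i) => x y; case: (mxtens_indexP j) => z w.
by rewrite mxE !vemb2E !tensmxE !mxE.
Qed.

Lemma vemb_tgt x : tgt (vemb x) \in codom emb.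
Proof. by have [_ _ ->] := legs_vemb E x; rewrite codom_f. Qed.

Lemma F_codom i j : Fmx D (vemb2 i) j != 0 -> j \in codom vemb2.
Proof.
case: (mxtens_indexP i) => x y; case: (mxtens_indexP j) => z w; rewrite vemb2E.
move=> /(@F_supp _ PD (vemb x) (vemb y) z w)[_ /eqP rt [h1 h2 h3 _]].
have [x1 x2 _] := legs_vemb E x; have [_ y2 _] := legs_vemb E y.
have cz : z \in codom vemb by apply: vemb_full; rewrite -?h2 -?h3 ?x2 ?y2 codom_f.
apply: vemb2_codom => //; apply: vemb_full; first by rewrite -h1 x1 codom_f.
by rewrite -rt; case/codomP: cz => z' ->; exact: vemb_tgt.
Qed.

Lemma is_topaut_restr al : is_topaut (restr_perm al) (aut_anti al) (restr_mx al).
Proof.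
have h := topautP al; split.
- by apply: (@emb_inj _ _ E); rewrite restr_permE emb_vac (topaut_vac h).
- by apply: (@emb_inj _ _ E); rewrite restr_permE emb_psi (topaut_psi h).
- by move=> x y; rewrite mxE => /(topaut_supp h)/legs_restr.
- by apply: sub_unitary (topaut_unitary h); exact: topaut_codom.
- rewrite -sub_F -sub_tens map_mxsub -!mulmx_sub ?(topaut_F h) //; try exact: vemb2_inj.
    by move=> i j; rewrite mxE fmorph_eq0; exact: F_codom.
  move=> i j; case: (mxtens_indexP i) => x y; case: (mxtens_indexP j) => z w.
  rewrite vemb2E tensmxE mulf_eq0 negb_or => /andP[/topaut_codom cz /topaut_codom cw].
  exact: vemb2_codom.
- rewrite -sub_R map_mxsub -!mulmx_sub ?(topaut_R h) //; try exact: vemb_inj.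
    by move=> x y; rewrite mxE fmorph_eq0; exact: R_codom.
  exact: topaut_codom.
- move=> x y hx /legs_restr hy; rewrite mxE (topaut_unit h) //.
  by have [-> -> _] := legs_vemb E x; rewrite -(emb_vac E); case: hx => ->; auto.
- move=> x hx; rewrite mxE (topaut_psipsi h) // legs_vemb.
  by case: hx => -> -> ->; rewrite emb_psi emb_vac.
Qed.

Definition restrict al : topaut B := mk_topaut (is_topaut_restr al).

Lemma restrictM al be : restrict (al * be)%g = (restrict al * restrict be)%g.
Proof.
apply: topaut_eq.
- apply/permP => a; apply: (@emb_inj _ _ E); rewrite [LHS]restr_permE.
  by rewrite !permM !restr_permE.
- by [].
- rewrite [LHS](mulmx_sub _ _ (@vemb_inj _ _ E)).
    by congr (_ *m _); rewrite map_mxsub.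
  by move=> x y; rewrite mxE fmorph_eq0; exact: topaut_codom.
Qed.

Lemma restrict_locality al : respects_locality al -> respects_locality (restrict al).
Proof.
move=> [g [n q e]]; exists (g \o emb); split.
- split=> [a|]; first exact: n.1.
  by rewrite /= emb_vac n.2.
- by rewrite /= emb_psi.
have e1 : aut_perm al = 1%g by rewrite /aut_perm e.
have e2 : aut_anti al = false by rewrite /aut_anti e.
have e3 : aut_mx al = nat_mx g by rewrite /aut_mx e.
rewrite /= e2; congr (_, _, _).
  by apply/permP => a; apply: (@emb_inj _ _ E); rewrite restr_permE e1 !perm1.
rewrite /restr_mx e3; apply/matrixP=> x y; rewrite !mxE (inj_eq (@vemb_inj _ _ E)).
by have [h1 h2 h3] := legs_vemb E x; rewrite /vertex_factor h1 h2 h3.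
Qed.

Definition restr (q : AutLR D) : AutLR B := bracket (restrict (repr q)).

Lemma restr_bracket al : restr (bracket al) = bracket (restrict al).
Proof.
have h := bracket_repr (bracket al); apply/bracketP.
move/bracketP/restrict_locality: h; rewrite restrictM.
suff -> : restrict (repr (bracket al))^-1%g = ((restrict (repr (bracket al)))^-1)%g by [].
apply: (mulIg (restrict (repr (bracket al)))); rewrite -restrictM !mulVg.
apply: (mulIg (restrict 1%g)); rewrite -restrictM !mul1g //.
Qed.

Lemma restrM (p q : AutLR D) : restr (p * q)%g = (restr p * restr q)%g.
Proof.
rewrite -(bracket_repr p) -(bracket_repr q) -bracketM !restr_bracket.
by rewrite restrictM bracketM.
Qed.
End Restriction.
End BraidedFusion.

Section Cohomology.
Local Open Scope group_scope.
Variables (G A : groupType) (K : A -> Prop) (act : G -> A -> A).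

(* K is an abelian subgroup of A on which G acts by automorphisms *)
Record is_gmodule : Prop := IsGModule {
  gmod1 : K 1;
  gmodM : forall x y, K x -> K y -> K (x * y);
  gmodV : forall x, K x -> K x^-1;
  gmodC : forall x y, K x -> K y -> x * y = y * x;
  gmod_act : forall g x, K x -> K (act g x);
  gmod_actM : forall g x y, K x -> K y -> act g (x * y) = act g x * act g y;
  gmod_act1 : forall x, K x -> act 1 x = x;
  gmod_actA : forall g h x, K x -> act (g * h) x = act g (act h x)
}.

Definition cocycle2 (c : G -> G -> A) : Prop :=
  (forall g h, K (c g h)) /\
  (forall g h k, act g (c h k) * c g (h * k) = c (g * h) k * c g h).

Definition coboundary2 (c : G -> G -> A) : Prop :=
  exists k : G -> A, (forall g, K (k g)) /\
    (forall g h, c g h = k g * act g (k h) * (k (g * h))^-1).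
End Cohomology.

Section Symmetry.
Local Open Scope group_scope.
Variables (C : numClosedFieldType) (G : groupType).

(* omega_2 = (-1)^w is a Z_2-valued 2-cocycle (for the trivial action) *)
Definition omega2 (w : G -> G -> bool) (g h : G) : int := ((-1) ^+ w g h)%R.

Definition omega2_cocycle (w : G -> G -> bool) : Prop :=
  forall g h k, (omega2 w h k * omega2 w g (h * k)%g
                  = omega2 w (g * h)%g k * omega2 w g h)%R.

Definition symmetry_law (B : fubfc C) (w : G -> G -> bool)
    (rho : G -> AutLR B) : Prop :=
  (respects_locality (Upsilon B) ->
    forall g h, rho g * rho h = rho (g * h)) /\
  (~ respects_locality (Upsilon B) ->
    forall g h, bracket (Upsilon B) ^+ w g h * rho g * rho h = rho (g * h)).

Record symmetry_action (B : fubfc C) (s : G -> bool) (w : G -> G -> bool)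
    (rho : G -> AutLR B) : Prop := SymmetryAction {
  sym_unitarity : forall g, antiunitary (rho g) = s g;
  sym_law : symmetry_law w rho
}.

Variables (B D : fubfc C) (sB : super_modular B) (E : min_mod_ext B D).

Definition ker_restr (q : AutLR D) : Prop := restr sB E q = 1.

Definition is_lift (rho : G -> AutLR B) (rhoc : G -> AutLR D) : Prop :=
  forall g, restr sB E (rhoc g) = rho g.

Definition lift_act (rhoc : G -> AutLR D) (g : G) (q : AutLR D) : AutLR D :=
  rhoc g * q * (rhoc g)^-1.

Definition o2 (w : G -> G -> bool) (rhoc : G -> AutLR D) (g h : G) : AutLR D :=
  if `[< respects_locality (Upsilon D) >]
  then rhoc (g * h) * (rhoc h)^-1 * (rhoc g)^-1
  else rhoc (g * h) * (rhoc h)^-1 * (rhoc g)^-1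
       * bracket (Upsilon D) ^+ w g h.
End Symmetry.

(* Main.v *)
Require Import Defs.
From HB Require Import structures.
From mathcomp Require Import all_boot all_order all_algebra.
From mathcomp Require Import complex reals.
From mathcomp Require Import perm boolp.

(** The class [Upsilon] of the larger category is a central involution which
    restricts to that of the smaller one, and it is trivial exactly when it
    respects locality.  Hence both branches of the definition of [o2] read
    [rhoc (g h) (rhoc h)^-1 (rhoc g)^-1 Upsilon^w(g,h)], and everything reduces
    to the obstruction theory of lifting a projective homomorphism through a
    group morphism [r] with abelian kernel: multiplying the lift [t] by a
    [ker r]-valued function [k] multiplies the obstruction by the coboundary of
    [k^-1]. *)

(** * Lifting a projective homomorphism through a group morphism with abelian kernel *)

Section ProjectiveLift.
Set Implicit Arguments.
Unset Strict Implicit.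
Local Open Scope group_scope.
Variables (G A A' : groupType) (r : A -> A') (c : G -> G -> A) (rho : G -> A').
Hypothesis rM : {morph r : x y / x * y}.
Hypothesis cC : forall g h x, c g h * x = x * c g h.
Hypothesis cc : forall g h, c g h * c g h = 1.
Hypothesis c_cocycle :
  forall g h k, c h k * c g (h * k) = c (g * h) k * c g h.
Hypothesis rhoM : forall g h, r (c g h) * rho g * rho h = rho (g * h).

Let K (x : A) : Prop := r x = 1.
Hypothesis KC : forall x y, K x -> K y -> x * y = y * x.

Definition conj_act (t : G -> A) (g : G) (x : A) : A := t g * x * (t g)^-1.
Definition lift_obs (t : G -> A) (g h : G) : A :=
  t (g * h) * (t h)^-1 * (t g)^-1 * c g h.
Definition lifts (t : G -> A) : Prop := forall g, r (t g) = rho g.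

Lemma morph_one : r 1 = 1.
Proof. by apply: (mulIg (r 1)); rewrite -rM !mul1g. Qed.

Lemma morph_inv x : r x^-1 = (r x)^-1.
Proof. by apply: (mulIg (r x)); rewrite -rM !mulVg morph_one. Qed.

Lemma conj_actM t g x y : conj_act t g (x * y) = conj_act t g x * conj_act t g y.
Proof. by rewrite /conj_act !mulgA mulgVK. Qed.

Lemma conj_actV t g x : conj_act t g x^-1 = (conj_act t g x)^-1.
Proof. by rewrite /conj_act !invgM invgK mulgA. Qed.

Lemma conj_act_central t g h k x : conj_act t g (x * c h k) = conj_act t g x * c h k.
Proof. by rewrite /conj_act -!mulgA cC. Qed.

Lemma conj_act_ker t g x : K x -> K (conj_act t g x).
Proof. by rewrite /K => e; rewrite !rM e mulg1 morph_inv mulgV. Qed.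

Lemma ker_mul x y : K x -> K y -> K (x * y).
Proof. by rewrite /K rM => -> ->; rewrite mulg1. Qed.

Lemma ker_inv x : K x -> K x^-1.
Proof. by rewrite /K morph_inv => ->; rewrite invg1. Qed.

(** Under [r] two factors [r (c g h)] appear, one from the projective law of [rho] and one from the
    correction term, and they cancel because [c g h] is an involution. *)
Lemma lift_obs_ker t : lifts t -> forall g h, K (lift_obs t g h).
Proof.
move=> tl g h; rewrite /K !rM !morph_inv !tl -rhoM !mulgK.
by rewrite -rM cc morph_one.
Qed.

Lemma lift_obsE t g h : t (g * h) = lift_obs t g h * c g h * t g * t h.
Proof. by rewrite /lift_obs -(mulgA _ (c g h) (c g h)) cc mulg1 !mulgVK. Qed.

Lemma conj_ker x y : K x -> K y -> x * y * x^-1 = y.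
Proof. by move=> Kx Ky; rewrite (KC Kx Ky) mulgK. Qed.

(** Conjugation by [t] need not define an action on all of [A]. On the kernel it does: [t (g * h)]
    differs from [t g * t h] by a central factor and a kernel factor, and both conjugate the abelian
    kernel trivially. *)
Lemma ker_gmodule t : lifts t -> is_gmodule K (conj_act t).
Proof.
move=> tl; have Ko := lift_obs_ker tl; split.
- exact: morph_one.
- exact: ker_mul.
- exact: ker_inv.
- exact: KC.
- by move=> g x; exact: conj_act_ker.
- by move=> g x y _ _; exact: conj_actM.
(* [t 1] may differ from 1; cancelling it in [lift_obsE] at [g = h = 1] shows that it is [c 1 1]
   times an element of the kernel. *)
- move=> x Kx; have e := lift_obsE t 1 1; move: (Ko 1 1) e.
  rewrite mulg1; move: (lift_obs _ _ _) => o oK.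
  rewrite -{1}[t 1]mul1g => /mulIg e.
  have t1 : t 1 = c 1 1 * o^-1.
    apply: (mulgI (o * c 1 1)); rewrite -e -(cC 1 1 o) -mulgA.
    by rewrite [o * _]mulgA -(cC 1 1 o) -mulgA mulgV mulg1 cc.
  have ox : o^-1 * x * o = x by rewrite -{2}(invgK o) conj_ker //; exact: ker_inv.
  have -> : conj_act t 1 x = c 1 1 * (o^-1 * x * o) * (c 1 1)^-1.
    by rewrite /conj_act t1 invgM invgK !mulgA.
  by rewrite ox cC mulgK.
- move=> g h x Kx; rewrite {1}/conj_act lift_obsE; have := Ko g h.
  move: (lift_obs _ _ _) => o oK; rewrite -(cC g h o) !invgM.
  have -> : c g h * o * t g * t h * x *
      ((t h)^-1 * ((t g)^-1 * (o^-1 * (c g h)^-1))) =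
    c g h * (o * conj_act t g (conj_act t h x) * o^-1) * (c g h)^-1.
    by rewrite /conj_act !mulgA.
  by rewrite (conj_ker oK) ?cC ?mulgK //; do 2!apply: conj_act_ker.
Qed.

Lemma lift_obs_cocycle t : lifts t -> cocycle2 K (conj_act t) (lift_obs t).
Proof.
move=> tl; have Ko := lift_obs_ker tl; split=> // g h k.
(* The telescoping identity below has the factors on the left in the opposite order. They are
   swapped before [c] is split off, since the uncorrected [o] need not take values in the kernel. *)
rewrite KC //; last exact: conj_act_ker.
pose o g h := t (g * h) * (t h)^-1 * (t g)^-1.
(* Both sides telescope to [t (g * h * k) * (t k)^-1 * (t h)^-1 * (t g)^-1]. *)
have oo : o g (h * k) * conj_act t g (o h k) = o (g * h) k * o g h.
  by rewrite /o /conj_act !mulgA !mulgVK.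
have lo x y : lift_obs t x y = o x y * c x y by [].
rewrite !lo conj_act_central.
rewrite -(mulgA _ (c g (h * k))) cC -(mulgA _ (c h k)) c_cocycle mulgA oo.
by rewrite -!(mulgA (o (g * h) k)) (mulgA (c _ k)) (cC _ k (o g h)) -(mulgA (o g h)).
Qed.

(** Only the central [c g h] moves past other factors, so [k] may be arbitrary; kernel-valued [k]
    later lets the factors be regrouped into a coboundary. *)
Lemma lift_obs_mul t k g h :
  lift_obs (fun g => k g * t g) g h =
    k (g * h) * lift_obs t g h * (conj_act t g (k h))^-1 * (k g)^-1.
Proof.
rewrite -conj_actV /lift_obs /conj_act !invgM !mulgA.
by rewrite -cC !mulgA -(cC g h (_ * _ * _ * _)) !mulgA mulgVK.
Qed.

Lemma lifts_div t t' : lifts t -> lifts t' -> forall g, K (t' g * (t g)^-1).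
Proof. by move=> tl tl' g; rewrite /K rM morph_inv tl tl' mulgV. Qed.

(** Two lifts differ by kernel elements, which conjugate the abelian kernel trivially; the module
    structure is thus independent of the lift. *)
Lemma conj_act_lifts t t' : lifts t -> lifts t' ->
  forall g x, K x -> conj_act t' g x = conj_act t g x.
Proof.
move=> tl tl' g x Kx; rewrite -(conj_ker (lifts_div tl tl' g) (conj_act_ker t g Kx)).
by rewrite /conj_act invgM invgK !mulgA !mulgVK.
Qed.

Lemma lift_obs_coboundary t t' : lifts t -> lifts t' ->
  coboundary2 K (conj_act t) (fun g h => lift_obs t' g h * (lift_obs t g h)^-1).
Proof.
move=> tl tl'; have Kk := lifts_div tl tl'.
(* The inverse is forced: [lift_obs_mul] produces [k (g * h)] uninverted, whereas a coboundary
   contains the inverse of that value. *)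
exists (fun g => (t' g * (t g)^-1)^-1); split=> [g|g h]; first exact: ker_inv.
pose k g := t' g * (t g)^-1.
have -> : lift_obs t' g h = lift_obs (fun g => k g * t g) g h.
  by rewrite /lift_obs /k !mulgVK.
rewrite lift_obs_mul -[(t' g / t g)^-1]/(k g)^-1 -[(t' h / t h)^-1]/(k h)^-1.
rewrite -[t' (g * h) / _]/(k (g * h)) conj_actV invgK.
rewrite -(mulgA _ (_^-1) ((k g)^-1)) -invgM.
have Kc := conj_act_ker t g (Kk h); have Ka := ker_mul (Kk g) Kc.
have Ko := lift_obs_ker tl g h.
rewrite (KC (ker_mul (Kk (g * h)) Ko) (ker_inv Ka)) mulgA mulgK.
by rewrite invgM (KC (ker_inv Kc) (ker_inv (Kk g))).
Qed.

Lemma lift_obs_trivial t :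
  (forall g h, c g h * t g * t h = t (g * h)) <-> (forall g h, lift_obs t g h = 1).
Proof.
split=> e g h; last by rewrite lift_obsE e mul1g.
by rewrite /lift_obs -e !mulgK cc.
Qed.

Lemma projective_lift t : lifts t ->
  (exists t', lifts t' /\ forall g h, c g h * t' g * t' h = t' (g * h)) <->
  coboundary2 K (conj_act t) (lift_obs t).
Proof.
move=> tl; split=> [[t' [tl' /lift_obs_trivial e]]|[k [Kk e]]].
  (* Since [t'] has trivial obstruction, the quotient is the obstruction of [t] itself. It is a
     coboundary for the action through [t'], which agrees with that through [t] on the kernel. *)
  have [k [Kk ek]] := lift_obs_coboundary tl' tl.
  exists k; split=> // g h; have := ek g h; rewrite e invg1 mulg1 => ->.
  by rewrite (conj_act_lifts tl tl').
(* Multiplying [t] by [k] divides the obstruction by the coboundary of [k], which is the obstruction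
   itself. *)
exists (fun g => k g * t g); split=> [g|]; first by rewrite rM Kk mul1g.
apply/lift_obs_trivial => g h; rewrite lift_obs_mul e -mulgA -invgM.
have Ka := conj_act_ker t g (Kk h); rewrite mulgA.
by rewrite (conj_ker (Kk (g * h)) (ker_mul (Kk g) Ka)) mulgV.
Qed.
End ProjectiveLift.

(** * The class of [Upsilon] as a central involution *)

Section UpsilonClass.
Set Implicit Arguments.
Unset Strict Implicit.
Import GRing.Theory.
Local Open Scope ring_scope.
Variables (C : numClosedFieldType) (B : fubfc C).

Lemma aut_mxM (al be : topaut B) :
  aut_mx (al * be)%g = map_mx (cconj (aut_anti al)) (aut_mx be) *m aut_mx al.
Proof. by []. Qed.

(** The matrix of [Upsilon] is diagonal with entries 1 and -1: these are real, so antilinear maps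
    cause no change, and they depend only on which legs are [psi], a label every autoequivalence
    fixes. *)
Lemma Upsilon_comm (al : topaut B) : (Upsilon B * al = al * Upsilon B)%g.
Proof.
apply: topaut_eq.
- by transitivity (aut_perm al * 1)%g; last by rewrite mulg1; apply/esym/mul1g.
- by transitivity (false (+) aut_anti al); last by rewrite addFb; apply/esym/addbF.
rewrite !aut_mxM /aut_mx /aut_anti /=; have h := topautP al.
apply/matrixP=> x y; rewrite map_diag_mx mul_mx_diag mul_diag_mx !mxE.
rewrite -/(aut_mx al) -/(aut_anti al).
have [->|/eqP T0] := aut_mx al x y =P 0%R; first by rewrite mul0r mulr0.
have [e1 e2 e3] := topaut_supp h T0.
have up a : upsilon_fun (aut_perm al a) = upsilon_fun a.
  by rewrite /upsilon_fun -[X in _ == X](topaut_psi h) (inj_eq perm_inj).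
have uc b a : cconj b (upsilon_fun a) = upsilon_fun a.
  by rewrite /upsilon_fun; case: ifP; rewrite ?rmorphN rmorph1.
by rewrite /vertex_factor e1 e2 e3 !up !rmorphM fmorphV /= !uc mulrC.
Qed.

Lemma bracket_Upsilon_comm (q : AutLR B) :
  (bracket (Upsilon B) * q = q * bracket (Upsilon B))%g.
Proof. by rewrite -(bracket_repr q) -!bracketM Upsilon_comm. Qed.

Lemma Upsilon_sq : (Upsilon B * Upsilon B = 1)%g.
Proof.
apply: topaut_eq => //; first exact: mul1g.
rewrite aut_mxM /aut_mx /=; apply/matrixP=> x y.
rewrite map_diag_mx mul_diag_mx !mxE mulrnAr.
have uu a : (upsilon_fun a : C) * upsilon_fun a = 1.
  by rewrite /upsilon_fun; case: ifP; rewrite ?mulrNN mulr1.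
have uV a : (upsilon_fun a : C)^-1 = upsilon_fun a.
  by rewrite /upsilon_fun; case: ifP; rewrite ?invrN invr1.
by rewrite /vertex_factor uV /= mulrACA uu mulr1 mulrACA !uu mulr1.
Qed.

Lemma bracket1 : bracket 1%g = 1%g :> AutLR B.
Proof. by apply: (mulgI (bracket 1%g)); rewrite -bracketM !mulg1. Qed.

Lemma bracket_Upsilon_sq : (bracket (Upsilon B) * bracket (Upsilon B) = 1)%g.
Proof. by rewrite -bracketM Upsilon_sq bracket1. Qed.

Lemma bracket_Upsilon_local : respects_locality (Upsilon B) ->
  bracket (Upsilon B) = 1%g.
Proof.
by move=> loc; rewrite -bracket1; apply/esym/bracketP; rewrite invg1 mul1g.
Qed.

(** A local [Upsilon] has trivial class, so the two cases merge; in this form the laws on [B] and on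
    [D] can be compared through [restr]. *)
Lemma symmetry_lawE (G : groupType) (w : G -> G -> bool) (rho : G -> AutLR B) :
  symmetry_law w rho <->
  forall g h, (bracket (Upsilon B) ^+ w g h * rho g * rho h = rho (g * h))%g.
Proof.
split=> [[loc nloc] g h|law]; last first.
  by split=> // /bracket_Upsilon_local e g h; rewrite -law e expg1n mul1g.
have [l|l] := pselect (respects_locality (Upsilon B)); last exact: nloc.
by rewrite -loc // bracket_Upsilon_local // expg1n mul1g.
Qed.
End UpsilonClass.

(** * Restriction of [Upsilon] from the modular extension *)

Section UpsilonRestriction.
Set Implicit Arguments.
Unset Strict Implicit.
Variables (C : numClosedFieldType) (B D : fubfc C).
Variables (sB : super_modular B) (E : min_mod_ext B D).

(** The embedding of labels is injective and sends [psi] to [psi], so the sign function of [D] pulls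
    back to that of [B]. *)
Lemma restrict_Upsilon : Defs.restrict sB E (Upsilon D) = Upsilon B.
Proof.
apply: topaut_eq => //.
  apply/permP => a; apply: (@emb_inj _ _ _ E); rewrite [LHS]restr_permE.
  by rewrite [LHS]perm1; congr (emb E _); apply/esym/perm1.
apply/matrixP=> x y; rewrite /aut_mx /= /restr_mx /aut_mx /= !mxE.
rewrite (inj_eq (@vemb_inj _ _ _ E)); congr (_ *+ _)%R.
have [e1 e2 e3] := legs_vemb E x; rewrite /vertex_factor e1 e2 e3.
have ue a : upsilon_fun (emb E a) = upsilon_fun a :> C.
  by rewrite /upsilon_fun -(emb_psi E) (inj_eq (@emb_inj _ _ _ E)).
by rewrite !ue.
Qed.

Lemma restr_Upsilon : restr sB E (bracket (Upsilon D)) = bracket (Upsilon B).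
Proof. by rewrite restr_bracket restrict_Upsilon. Qed.
End UpsilonRestriction.

(** * The obstruction [o2] as an instance of the general lifting problem *)

Lemma o2E (C : numClosedFieldType) (D : fubfc C) (G : groupType)
    (w : G -> G -> bool) (t : G -> AutLR D) (g h : G) :
  o2 w t g h = lift_obs (fun g h => bracket (Upsilon D) ^+ w g h)%g t g h.
Proof.
rewrite /o2 /lift_obs; case: asboolP => // loc.
by rewrite bracket_Upsilon_local // expg1n mulg1.
Qed.

Theorem mainTheorem9 (R : realType) (B D : fubfc R[i])
    (sB : super_modular B) (E : min_mod_ext B D)
    (Gb : groupType)
    (s : Gb -> bool) (hs : forall g h : Gb, s (g * h)%g = s g (+) s h)
    (w : Gb -> Gb -> bool) (hw : omega2_cocycle w)
    (rho : Gb -> AutLR B) (hrho : symmetry_action s w rho)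
    (hker : forall x y : AutLR D, ker_restr sB E x -> ker_restr sB E y ->
      (x * y)%g = (y * x)%g)
    (hlift : forall g : Gb, exists q : AutLR D, restr sB E q = rho g) :
  (forall rhoc : Gb -> AutLR D, is_lift sB E rho rhoc ->
    is_gmodule (ker_restr sB E) (lift_act rhoc) /\
    cocycle2 (ker_restr sB E) (lift_act rhoc) (o2 w rhoc)) /\
  (forall rhoc rhoc' : Gb -> AutLR D,
    is_lift sB E rho rhoc -> is_lift sB E rho rhoc' ->
    (forall (g : Gb) (x : AutLR D), ker_restr sB E x ->
      lift_act rhoc' g x = lift_act rhoc g x) /\
    coboundary2 (ker_restr sB E) (lift_act rhoc)
      (fun g h => (o2 w rhoc' g h * (o2 w rhoc g h)^-1)%g)) /\
  (forall rhoc : Gb -> AutLR D, is_lift sB E rho rhoc ->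
    ((exists rhoc' : Gb -> AutLR D,
       is_lift sB E rho rhoc' /\ symmetry_law w rhoc') <->
     coboundary2 (ker_restr sB E) (lift_act rhoc) (o2 w rhoc))).
Proof.
pose c g h := (bracket (Upsilon D) ^+ w g h)%g.
have -> : @o2 _ Gb D w = lift_obs c.
  by apply/funext => t; apply/funext => g; apply/funext => h; exact: o2E.
have rM := restrM sB E.
have cC g h x : (c g h * x = x * c g h)%g.
  rewrite /c; case: (w g h); last by rewrite mul1g mulg1.
  exact: bracket_Upsilon_comm.
have cc g h : (c g h * c g h = 1)%g.
  rewrite /c; case: (w g h); last exact: mul1g.
  exact: bracket_Upsilon_sq.
have c_cocycle g h k : (c h k * c g (h * k) = c (g * h) k * c g h)%g.
  (* Both -1 and the class of [Upsilon] square to 1, so the total exponent on each side matters only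
     modulo 2: each assignment of the four bits either contradicts [hw] or satisfies the goal. *)
  move: (hw g h k); rewrite /omega2 /c; have uu := bracket_Upsilon_sq D.
  by case: (w h k); case: (w g (h * k)%g); case: (w (g * h)%g k); case: (w g h);
    rewrite //= ?expg1 ?expg0 ?mulg1 ?mul1g ?uu.
have rhoM g h : (restr sB E (c g h) * rho g * rho h = rho (g * h))%g.
  (* The twist in the law of [rho] is the restriction of [c], because [restr] sends the class of
     [Upsilon D] to that of [Upsilon B]. *)
  have /symmetry_lawE <- := sym_law hrho; rewrite /c.
  case: (w g h); last by rewrite (morph_one rM).
  by rewrite restr_Upsilon.
split=> [t tl|]; first split.
- exact: (ker_gmodule rM cC cc rhoM hker tl).
- exact: (lift_obs_cocycle rM cC cc c_cocycle rhoM hker tl).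
split=> [t t' tl tl'|t tl]; first split.
- exact: (conj_act_lifts rM hker tl tl').
- exact: (lift_obs_coboundary rM cC cc rhoM hker tl tl').
have [p1 p2] := projective_lift rM cC cc rhoM hker tl.
split=> [[t' [tl' /symmetry_lawE law]]|/p2 [t' [tl' law]]].
  by apply: p1; exists t'.
by exists t'; split=> //; apply/symmetry_lawE.
Qed.
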